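(* Let $M\subset\mathbb{R}^5$ be a corank $1$ $3$-manifold at the origin $p$, locally parametrised by a smooth map germ $f:(\mathbb{R}^3,0)\to(\mathbb{R}^5,0)$ such that $$f(x,y,z)=\bigl(x,\,y,\,a_{21}z^2+a_{22}xz+a_{12}yz,\,b_{21}z^2+b_{22}xz+b_{12}yz,\,c_{21}z^2+c_{22}xz+c_{12}yz\bigr)+R(x,y,z),$$ where the coefficients $a_{ij},b_{ij},c_{ij}$ are real constants and $R$ consists of terms of order at least $3$. Let $\Delta_p$ be the curvature locus of $M$ at $p$. Then: (i) $j^2f(0)\sim_{\mathcal{A}^2}(x,y,xz,yz,z^2)$ if and only if $\Delta_p$ is a substantial surface; (ii) $j^2f(0)\sim_{\mathcal{A}^2}(x,y,z^2,xz,0)$ if and only if $\Delta_p$ is a planar region; (iii) $j^2f(0)\sim_{\mathcal{A}^2}(x,y,xz,yz,0)$ if and only if $\Delta_p$ is a plane; (iv) $j^2f(0)\sim_{\mathcal{A}^2}(x,y,z^2,0,0)$ if and only if $\Delta_p$ is a half-line; (v) $j^2f(0)\sim_{\mathcal{A}^2}(x,y,xz,0,0)$ if and only if $\Delta_p$ is a line; (vi) $j^2f(0)\sim_{\mathcal{A}^2}(x,y,0,0,0)$ if and only if $\Delta_p$ is a point.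
   Context: For a smooth germ $f:(\mathbb{R}^3,0)\to(\mathbb{R}^5,0)$ of corank $1$ (i.e. $df_0$ has rank $2$) parametrising $M$ at $p=f(0)$, the tangent space is $T_pM=\mathrm{Im}(df_0)$ (dimension $2$), the normal space $N_pM$ is its orthogonal complement in $\mathbb{R}^5$ (dimension $3$), and $w\mapsto w^{\perp}$ is the orthogonal projection onto $N_pM$. The first fundamental form is the pseudometric $\mathcal{I}(\mathbf{u},\mathbf{v})=\langle df_0(\mathbf{u}),df_0(\mathbf{v})\rangle$ on $\mathbb{R}^3$. The second fundamental form is the symmetric bilinear map $\mathcal{II}:\mathbb{R}^3\times\mathbb{R}^3\to N_pM$ with $\mathcal{II}(\partial_i,\partial_j)=\left(\frac{\partial^2 f}{\partial x_i\partial x_j}(0)\right)^{\perp}$, where $(x_1,x_2,x_3)=(x,y,z)$. The curvature locus is $\Delta_p=\{\mathcal{II}(\mathbf{u},\mathbf{u}) : \mathbf{u}\in\mathbb{R}^3,\ \mathcal{I}(\mathbf{u},\mathbf{u})=1\}\subset N_pM$. $j^2f(0)$ is the $2$-jet (degree $\le 2$ Taylor polynomial) of $f$ at $0$; $j^2f(0)\sim_{\mathcal{A}^2}j^2g(0)$ means that there are diffeomorphism germs $\psi$ of $(\mathbb{R}^3,0)$ and $\Phi$ of $(\mathbb{R}^5,0)$ with $j^2(\Phi\circ f\circ\psi)(0)=j^2g(0)$. A substantial surface is a surface whose Gaussian curvature is not identically zero. A planar region is a two-dimensional region of a plane (contained in a plane but not in a line) which is not the whole plane. A plane, line or half-line in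 $N_pM$ means an entire affine plane, an entire affine line, or a ray (not necessarily with endpoint at the origin). *)

(* Defs.v *)
From HB Require Import structures.
From mathcomp Require Import all_boot all_order all_algebra.
From mathcomp Require Import all_classical all_reals all_analysis.
Import Order.TTheory GRing.Theory Num.Theory.
Import numFieldNormedType.Exports.

Set Implicit Arguments.
Unset Strict Implicit.
Unset Printing Implicit Defensive.

Local Open Scope classical_set_scope.
Local Open Scope ring_scope.

Section Smooth.
Variable R : realType.

Fixpoint Ck_on (V W : normedModType R) (k : nat) (U : set V) (f : V -> W) : Prop :=
  if k is k'.+1 then
    (forall x, U x -> differentiable f x) /\ forall v, Ck_on k' U ('D_v f)
  else forall x, U x -> {for x, continuous f}.

Definition smooth_on (V W : normedModType R) (U : set V) (f : V -> W) : Prop :=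
  forall k, Ck_on k U f.

(* A germ at the origin is given by a total representative; only its values
   near 0 matter. *)
Definition smooth_germ (V W : normedModType R) (f : V -> W) : Prop :=
  exists U : set V, [/\ open U, U 0 & smooth_on U f].

Definition diffeo_germ (V : normedModType R) (psi : V -> V) : Prop :=
  [/\ psi 0 = 0, smooth_germ psi &
      exists phi : V -> V,
        [/\ phi 0 = 0, smooth_germ phi,
            \forall x \near (0 : V), phi (psi x) = x &
            \forall x \near (0 : V), psi (phi x) = x]].

End Smooth.

Section Jets.
Variable R : realType.

Definition partial (n m : nat) (i : 'I_n) (f : 'rV[R]_n -> 'rV[R]_m) :
  'rV[R]_n -> 'rV[R]_m := 'D_(delta_mx 0 i) f.

Definition jet2 (n m : nat) (f : 'rV[R]_n -> 'rV[R]_m) : 'rV[R]_n -> 'rV[R]_m :=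
  fun u => f 0 + \sum_i u 0 i *: partial i f 0
         + 2^-1 *: \sum_i \sum_j (u 0 i * u 0 j) *: partial i (partial j f) 0.

Definition A2_equiv (n m : nat) (f g : 'rV[R]_n -> 'rV[R]_m) : Prop :=
  exists (psi : 'rV[R]_n -> 'rV[R]_n) (Phi : 'rV[R]_m -> 'rV[R]_m),
    [/\ diffeo_germ psi, diffeo_germ Phi & jet2 (Phi \o f \o psi) = jet2 g].

End Jets.

Section CurvatureLocus.
Variable R : realType.

Definition dot (n : nat) (u v : 'rV[R]_n) : R := \sum_i u 0 i * v 0 i.

Variables (n m : nat) (f : 'rV[R]_n -> 'rV[R]_m).

(* Subspaces are row spaces: the rows of 'J f 0 are the partial derivatives of
   f at 0, so they span Im(df_0); u *m A^T = 0 says that u is orthogonal to the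
   rows of A. *)
Definition tangent_subspace : 'M[R]_m := <<'J f 0>>%MS.

Definition normal_subspace : 'M[R]_m := kermx ('J f 0)^T.

Definition normal_part (w : 'rV[R]_m) : 'rV[R]_m :=
  w *m proj_mx normal_subspace tangent_subspace.

Definition first_form (u v : 'rV[R]_n) : R := dot ('d f 0 u) ('d f 0 v).

Definition second_form (u v : 'rV[R]_n) : 'rV[R]_m :=
  \sum_i \sum_j (u 0 i * v 0 j) *: normal_part (partial i (partial j f) 0).

Definition curvature_locus : set 'rV[R]_m :=
  [set second_form u u | u in [set u | first_form u u = 1]].

End CurvatureLocus.

Definition corank1_germ (R : realType) (f : 'rV[R]_3 -> 'rV[R]_5) : Prop :=
  [/\ f 0 = 0, smooth_germ f & \rank ('J f 0) = 2%N].

Section Shapes.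
Variables (R : realType) (n : nat).
Implicit Type S : set 'rV[R]_n.

Definition is_flat (k : nat) S : Prop :=
  exists (q : 'rV[R]_n) (B : 'M[R]_(k, n)),
    row_free B /\ S = [set q + t *m B | t in [set: 'rV[R]_k]].

Definition is_plane S : Prop := is_flat 2 S.

Definition is_line S : Prop := is_flat 1 S.

Definition is_half_line S : Prop :=
  exists q v : 'rV[R]_n, v != 0 /\ S = [set q + t *: v | t in [set t : R | 0 <= t]].

Definition is_point S : Prop := exists q : 'rV[R]_n, S = [set q].

(* A region is a nonempty connected (relatively) open set together with some,
   all or none of its boundary points. *)
Definition region_of (P S : set 'rV[R]_n) : Prop :=
  exists O : set 'rV[R]_n,
    [/\ open O, P `&` O !=set0, connected (P `&` O),
        P `&` O `<=` S & S `<=` closure (P `&` O)].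

Definition is_planar_region S : Prop :=
  exists P : set 'rV[R]_n,
    [/\ is_plane P, S `<=` P, region_of P S,
        ~ (exists2 L, is_line L & S `<=` L) & S <> P].

(* phi : U -> S `&` V is a local parametrisation of S: a smooth immersion that
   is a homeomorphism onto the relatively open subset S `&` V of S. *)
Definition local_parametrisation S (U : set 'rV[R]_2) (V : set 'rV[R]_n)
    (phi : 'rV[R]_2 -> 'rV[R]_n) : Prop :=
  [/\ open U, open V, smooth_on U phi /\ phi @` U = S `&` V,
      forall x, U x -> \rank ('J phi x) = 2%N &
      exists psi : 'rV[R]_n -> 'rV[R]_2,
        {within S `&` V, continuous psi} /\ forall x, U x -> psi (phi x) = x].

Definition regular_surface S : Prop :=
  forall q, S q -> exists U V phi, V q /\ local_parametrisation S U V phi.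

(* (e g - f^2) / (E G - F^2) at the point phi x, computed with the normal nu. *)
Definition curvature_formula (phi : 'rV[R]_2 -> 'rV[R]_n) (nu : 'rV[R]_n)
    (x : 'rV[R]_2) : R :=
  let D i := partial i phi x in
  let h i j := dot nu (partial i (partial j phi) x) in
  (h 0 0 * h 1 1 - h 0 1 ^+ 2)
  / (dot (D 0) (D 0) * dot (D 1) (D 1) - dot (D 0) (D 1) ^+ 2).

(* K is the Gaussian curvature at q of the surface S in the Euclidean space W.
   When W has dimension 3, the unit normal nu in W is unique up to sign and K
   does not depend on the choices. *)
Definition gaussian_curvature (W : 'M[R]_n) S (q : 'rV[R]_n) (K : R) : Prop :=
  exists U V phi x nu,
    [/\ local_parametrisation S U V phi, U x /\ phi x = q,
        (nu <= W)%MS /\ dot nu nu = 1,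
        forall i, dot nu (partial i phi x) = 0 &
        K = curvature_formula phi nu x].

Definition substantial_surface (W : 'M[R]_n) S : Prop :=
  [/\ forall q, S q -> (q <= W)%MS, regular_surface S &
      exists q K, [/\ S q, gaussian_curvature W S q K & K != 0]].

End Shapes.

Definition map35 (R : realType) (F : R -> R -> R -> seq R) (u : 'rV[R]_3) : 'rV[R]_5 :=
  \row_(i < 5) (F (u 0 0) (u 0 1) (u 0 2))`_i.

(* Main.v *)
Require Import Defs.
From HB Require Import structures.
From mathcomp Require Import all_boot all_order all_algebra.
From mathcomp Require Import all_classical all_reals all_analysis.
From mathcomp Require Import perm zify ring lra.
Import Order.TTheory GRing.Theory Num.Theory.
Import numFieldNormedType.Exports.

Set Implicit Arguments.
Unset Strict Implicit.
Unset Printing Implicit Defensive.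

Local Open Scope classical_set_scope.
Local Open Scope ring_scope.

(** Write the quadratic part of [f] as [z * (u *m N)], where [u = (x, y, z)] and
    the rows of [N] are the vectors [B], [C], [A] of coefficients of [xz], [yz],
    [z^2] in the normal directions.  Both sides of each equivalence depend only
    on two invariants: the rank of [N], and whether its last row [A] vanishes.

    On the side of the 2-jets ([A2_equiv_rank]), the kernel of [df_0] is the
    [z]-axis.  A change of source relating two such jets therefore maps the
    [z]-axis to itself to first order, and a change of target preserves the
    tangent plane and acts linearly on the quotient by it; its quadratic part
    only adds quadratic forms in [x, y].  Comparing the quadratic parts at [u + e] and [u - e], with
    [e] the unit vector of the [z]-axis, cancels those forms and leaves an
    equation between matrices, which shows that the two invariants are
    preserved.  Conversely, the two invariants classify matrices under the
    corresponding row and column operations ([flag_equivP]), and such operations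
    are realised by a linear change of source and a quadratic change of target,
    the latter absorbing the forms in [x, y] that appear when squares are
    completed.  The six normal forms realise the six possible values of the
    invariants.

    On the side of the curvature locus, the condition [I(u, u) = 1] reads
    [x^2 + y^2 = 1], so that [(s, t) = z (x, y)] ranges over the whole plane and
    [s^2 + t^2 = z^2].  Hence the locus is the image of
    [(s, t) |-> 2 (s B + t C + (s^2 + t^2) A)] ([curvature_locus_paraboloid]).
    This image contains the origin and its linear span is the row space of [N].
    If [A = 0] it is that span: a plane, a line or a point.  If [A] is not zero
    it never is a linear subspace: for rank 1, completing squares gives a
    half-line; for rank 2, a rotation of [(s, t)] makes the image the region
    bounded by a parabola; for rank 3 it is a paraboloid of revolution up to a
    linear map, an embedded surface curved at its vertex.  The shapes exclude
    each other: the dimension of the span separates most of them, linearity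
    separates the rest, and a surface contained in a plane has zero curvature. *)

(** * First and second derivatives at a point *)

Lemma derive_partial (R : realType) n m (f : 'rV[R]_n -> 'rV[R]_m) (x : 'rV[R]_n) v :
  differentiable f x -> 'D_v f x = \sum_i v 0 i *: partial i f x.
Proof.
move=> df; rewrite /partial (deriveE _ df) {1}[v]row_sum_delta linear_sum.
by apply: eq_bigr => i _; rewrite linearZ /= (deriveE _ df).
Qed.

Lemma jacobian_partial (R : realType) n m (f : 'rV[R]_n -> 'rV[R]_m) (x : 'rV[R]_n) v :
  differentiable f x -> v *m 'J f x = \sum_i v 0 i *: partial i f x.
Proof. by move=> df; rewrite -derive_partial// deriveEjacobian. Qed.

Lemma row_jacobian (R : realType) n m (f : 'rV[R]_n -> 'rV[R]_m) (x : 'rV[R]_n) i :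
  differentiable f x -> row i ('J f x) = partial i f x.
Proof. by move=> df; rewrite rowE -deriveEjacobian. Qed.

Lemma eq_near_jacobian (R : realType) n m (f g : 'rV[R]_n -> 'rV[R]_m) (x : 'rV[R]_n) :
  differentiable f x -> differentiable g x ->
  (\forall y \near x, f y = g y) -> 'J f x = 'J g x.
Proof.
move=> df dg fg; apply/row_matrixP => i.
apply: etrans (row_jacobian i df) _; apply: etrans (esym (row_jacobian i dg)).
exact: near_eq_derive.
Qed.

Lemma jacobian_comp (R : realType) n m p (h : 'rV[R]_n -> 'rV[R]_m)
    (g : 'rV[R]_m -> 'rV[R]_p) (x : 'rV[R]_n) :
  differentiable h x -> differentiable g (h x) ->
  'J (g \o h) x = 'J h x *m 'J g (h x).
Proof.
move=> dh dg; apply/row_matrixP => i.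
by rewrite !rowE mulmxA /jacobian !mul_rV_lin1 diff_comp.
Qed.

Lemma jacobianD (R : realType) n m (f g : 'rV[R]_n -> 'rV[R]_m) (x : 'rV[R]_n) :
  differentiable f x -> differentiable g x -> 'J (f + g) x = 'J f x + 'J g x.
Proof.
move=> df dg; apply/row_matrixP => i; rewrite linearD /=.
apply: etrans (congr2 +%R (esym (row_jacobian i df)) (esym (row_jacobian i dg))).
apply: etrans (row_jacobian i (differentiableD df dg)) _.
by apply: deriveD; apply: diff_derivable.
Qed.

Lemma differentiable_rV (R : realType) (V : normedModType R) m
    (f : V -> 'rV[R]_m) (x : V) :
  (forall k, differentiable (fun y => f y 0 k : R) x) -> differentiable f x.
Proof.
move=> df; have -> : f = \sum_k (fun y => f y 0 k *: delta_mx 0 k).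
  by apply/funext => y; rewrite fct_sumE [LHS]row_sum_delta.
by apply: differentiable_sum => k; apply: differentiableZl.
Qed.

Lemma differentiable_entry (R : realType) (V : normedModType R) m
    (f : V -> 'rV[R]_m) (x : V) k :
  differentiable f x -> differentiable (fun y => f y 0 k : R) x.
Proof.
move=> df; apply: (@differentiable_comp _ _ _ _ f (fun N : 'rV_m => N 0 k)) => //.
exact: differentiable_coord.
Qed.

Lemma derive_entry (R : realType) (V : normedModType R) m
    (f : V -> 'rV[R]_m) (x : V) v k :
  differentiable f x -> ('D_v f x) 0 k = 'D_v (fun y => f y 0 k : R) x.
Proof. by move=> df; rewrite derive_mx ?mxE//; apply: diff_derivable. Qed.

Lemma differentiable_scale (R : realType) (V : normedModType R) m
    (a : V -> R) (b : V -> 'rV[R]_m) (x : V) :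
  differentiable a x -> differentiable b x ->
  differentiable (fun y => a y *: b y) x.
Proof.
move=> da db; apply: differentiable_rV => k.
rewrite (_ : (fun _ => _) = a * (fun y => b y 0 k)).
  by apply: differentiableM => //; exact: differentiable_entry.
by apply/funext => y; rewrite mxE.
Qed.

Lemma derive_scale (R : realType) (V : normedModType R) m
    (a : V -> R) (b : V -> 'rV[R]_m) (x : V) v :
  differentiable a x -> differentiable b x ->
  'D_v (fun y => a y *: b y) x = a x *: 'D_v b x + 'D_v a x *: b x.
Proof.
move=> da db; apply/rowP => k; rewrite derive_entry; last first.
  exact: differentiable_scale.
rewrite (_ : (fun _ => _) = a * (fun y => b y 0 k)).
  rewrite deriveM; [|exact: diff_derivable|].
    by rewrite !mxE -derive_entry// mulrC [X in _ + X]mulrC [X in X + _]mulrC.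
  by apply: diff_derivable; apply: differentiable_entry.
by apply/funext => y; rewrite mxE.
Qed.

(** Exactly what is needed for the second-order chain rule at [x]; it is
    implied by smoothness and stable under composition. *)
Definition twice_differentiable (R : realType) n m
    (f : 'rV[R]_n -> 'rV[R]_m) (x : 'rV[R]_n) : Prop :=
  (\forall y \near x, differentiable f y) /\
  forall i, differentiable (partial i f) x.

(** The second-order part of [f] at [x], as a quadratic map of [u].  It sees
    the symmetric part of the second derivatives, which is all that 2-jets and
    the curvature locus depend on. *)
Definition hess (R : realType) n m (f : 'rV[R]_n -> 'rV[R]_m) (x u : 'rV[R]_n) : 'rV[R]_m :=
  \sum_i \sum_j (u 0 i * u 0 j) *: partial i (partial j f) x.

Lemma hess_partial (R : realType) n m (f : 'rV[R]_n -> 'rV[R]_m) (x u : 'rV[R]_n) :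
  twice_differentiable f x ->
  hess f x u = \sum_j u 0 j *: 'D_u (partial j f) x.
Proof.
move=> [_ df]; rewrite /hess exchange_big; apply: eq_bigr => j _.
rewrite derive_partial// scaler_sumr; apply: eq_bigr => i _.
by rewrite scalerA mulrC.
Qed.

Lemma smooth_twice_differentiable (R : realType) n m
    (f : 'rV[R]_n -> 'rV[R]_m) :
  smooth_germ f -> twice_differentiable f 0.
Proof.
move=> [U [oU U0 sf]]; have [df ddf] := sf 2; split.
  by near=> y; apply: df; near: y; exact: open_nbhs_nbhs.
by move=> i; have [+ _] := ddf (delta_mx 0 i); exact.
Unshelve. all: by end_near. Qed.

Lemma twice_differentiable_at (R : realType) n m (f : 'rV[R]_n -> 'rV[R]_m) (x : 'rV[R]_n) :
  twice_differentiable f x -> differentiable f x.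
Proof. by case=> /nbhs_singleton. Qed.

Lemma diffeo_jacobian_unit (R : realType) n (psi : 'rV[R]_n -> 'rV[R]_n) :
  diffeo_germ psi -> 'J psi 0 \in unitmx.
Proof.
move=> [psi0 /smooth_twice_differentiable/twice_differentiable_at dpsi].
move=> [phi [phi0 /smooth_twice_differentiable/twice_differentiable_at dphi _ K]].
have dpsi' : differentiable psi (phi 0) by rewrite phi0.
have J1 : 'J phi 0 *m 'J psi 0 = 1%:M.
  have dpp : differentiable (psi \o phi) 0 by exact: differentiable_comp.
  rewrite -[X in _ *m 'J psi X]phi0 -jacobian_comp//.
  rewrite (@eq_near_jacobian _ _ _ (psi \o phi) id)//.
  apply/row_matrixP => i; rewrite (row_jacobian i _)//.
  by rewrite /partial derive_id rowE mulmx1.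
by have [] := mulmx1_unit J1.
Qed.

Lemma near_partial (R : realType) n m (f g : 'rV[R]_n -> 'rV[R]_m) (x : 'rV[R]_n) i :
  (\forall y \near x, f y = g y) ->
  \forall y \near x, partial i f y = partial i g y.
Proof.
move=> /near_join fg; near=> y; apply: near_eq_derive; near: y; exact: fg.
Unshelve. all: by end_near. Qed.

Lemma eq_near_hess (R : realType) n m (f g : 'rV[R]_n -> 'rV[R]_m) (x u : 'rV[R]_n) :
  (\forall y \near x, f y = g y) -> hess f x u = hess g x u.
Proof.
move=> fg.
have e i j : partial i (partial j f) x = partial i (partial j g) x.
  exact: (near_eq_derive _ (near_partial j fg)).
rewrite /hess.
by apply: eq_bigr => i _; apply: eq_bigr => j _; exact: (congr1 _ (e i j)).
Qed.

(** Differentiability is a property of germs, but its definition mentions the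
    function globally; a germ equal to zero is the basic case, from which
    [near_differentiable] follows by adding the difference. *)
Lemma near0_differentiable (R : realType) (V W : normedModType R) (f : V -> W)
    (x : V) :
  (\forall y \near x, f y = 0) -> differentiable f x.
Proof.
move=> f0.
have e0 : f \o shift x = cst (f x) + \0 +o_ 0 id.
  apply/eqaddoP => e e_gt0; near=> h.
  rewrite !fctE (nbhs_singleton f0) /= !add0r oppr0 addr0.
  suff -> : f (h + x) = 0 by rewrite normr0 mulr_ge0// ltW.
  by near: h; move: f0; rewrite (near_shift 0) /=; apply: filterS => h /=; rewrite subr0.
have c0 : continuous (\0 : V -> W) by exact: cst_continuous.
apply/diff_locallyP; have /= -> := diff_unique c0 e0; split => //.
Unshelve. all: by end_near. Qed.

Lemma near_differentiable (R : realType) (V W : normedModType R) (f g : V -> W)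
    (x : V) :
  (\forall y \near x, f y = g y) -> differentiable f x -> differentiable g x.
Proof.
move=> fg df; rewrite (_ : g = f + (g - f)); last by rewrite addrC subrK.
apply: differentiableD => //; apply: near0_differentiable.
by apply: filterS fg => y fg; rewrite !fctE fg subrr.
Qed.

Lemma partial_comp (R : realType) n m p (h : 'rV[R]_n -> 'rV[R]_m)
    (g : 'rV[R]_m -> 'rV[R]_p) (x : 'rV[R]_n) i :
  differentiable h x -> differentiable g (h x) ->
  partial i (g \o h) x = \sum_k (partial i h x) 0 k *: partial k g (h x).
Proof.
move=> dh dg; rewrite /partial deriveE; last exact: differentiable_comp.
rewrite diff_comp//= -(deriveE _ dh) -(deriveE _ dg).
exact: derive_partial.
Qed.

(** The chain rule for first derivatives holds near [x] and not only at [x],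
    hence can be differentiated once more. *)
Lemma near_partial_comp (R : realType) n m p (h : 'rV[R]_n -> 'rV[R]_m)
    (g : 'rV[R]_m -> 'rV[R]_p) (x : 'rV[R]_n) i :
  twice_differentiable h x -> twice_differentiable g (h x) ->
  \forall y \near x, \sum_k (partial i h y) 0 k *: partial k g (h y) =
                     partial i (g \o h) y.
Proof.
move=> dh dg.
have ch : {for x, continuous h}.
  exact/differentiable_continuous/twice_differentiable_at.
have dgh : \forall y \near x, differentiable g (h y) := ch _ dg.1.
near=> y; apply/esym/partial_comp; near: y => //; exact: dh.1.
Unshelve. all: by end_near. Qed.

Lemma differentiable_sum_scale (R : realType) n m p (h : 'rV[R]_n -> 'rV[R]_m)
    (b : 'I_m -> 'rV[R]_n -> 'rV[R]_p) (x : 'rV[R]_n) :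
  differentiable h x -> (forall k, differentiable (b k) x) ->
  differentiable (fun y => \sum_k (h y) 0 k *: b k y) x.
Proof.
move=> dh db; rewrite (_ : (fun _ => _) = \sum_k fun y => (h y) 0 k *: b k y).
  apply: differentiable_sum => k; apply: differentiable_scale => //.
  exact: differentiable_entry.
by apply/funext => y; rewrite fct_sumE.
Qed.

Lemma derive_sum_scale (R : realType) n m p (h : 'rV[R]_n -> 'rV[R]_m)
    (b : 'I_m -> 'rV[R]_n -> 'rV[R]_p) (x v : 'rV[R]_n) :
  differentiable h x -> (forall k, differentiable (b k) x) ->
  'D_v (fun y => \sum_k (h y) 0 k *: b k y) x =
  \sum_k ((h x) 0 k *: 'D_v (b k) x + ('D_v h x) 0 k *: b k x).
Proof.
move=> dh db; rewrite (_ : (fun _ => _) = \sum_k fun y => (h y) 0 k *: b k y).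
  rewrite derive_sum => [|k]; last first.
    apply: diff_derivable; apply: differentiable_scale => //.
    exact: differentiable_entry.
  apply: eq_bigr => k _; rewrite derive_scale//; last exact: differentiable_entry.
  by rewrite derive_entry.
by apply/funext => y; rewrite fct_sumE.
Qed.

Lemma twice_differentiable_comp (R : realType) n m p
    (h : 'rV[R]_n -> 'rV[R]_m) (g : 'rV[R]_m -> 'rV[R]_p) (x : 'rV[R]_n) :
  twice_differentiable h x -> twice_differentiable g (h x) ->
  twice_differentiable (g \o h) x.
Proof.
move=> dh dg; have ch : {for x, continuous h}.
  exact/differentiable_continuous/twice_differentiable_at.
have dgh : \forall y \near x, differentiable g (h y) := ch _ dg.1.
split=> [|i].
  near=> y; apply: differentiable_comp; near: y => //; exact: dh.1.
apply: near_differentiable (near_partial_comp i dh dg) _.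
apply: differentiable_sum_scale => [|k]; first exact: dh.2.
apply: differentiable_comp; last exact: dg.2.
exact: twice_differentiable_at.
Unshelve. all: by end_near. Qed.

(** Differentiating the product in the first-order chain rule gives two terms:
    the second derivatives of [h] pushed by [g], and those of [g] along [h]. *)
Lemma hess_comp (R : realType) n m p
    (h : 'rV[R]_n -> 'rV[R]_m) (g : 'rV[R]_m -> 'rV[R]_p) (x u : 'rV[R]_n) :
  twice_differentiable h x -> twice_differentiable g (h x) ->
  hess (g \o h) x u =
  hess h x u *m 'J g (h x) + hess g (h x) (u *m 'J h x).
Proof.
move=> dh dg; have dhx := twice_differentiable_at dh.
have dgx := twice_differentiable_at dg.
have Dgh k : 'D_u (partial k g \o h) x = 'D_(u *m 'J h x) (partial k g) (h x).
  have dk := dg.2 k.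
  rewrite deriveE; last exact: differentiable_comp.
  by rewrite diff_comp//= -(deriveE _ dhx) -(deriveE _ dk) (deriveEjacobian u dhx).
have Dj j : 'D_u (partial j (g \o h)) x =
   \sum_k (partial j h x) 0 k *: 'D_(u *m 'J h x) (partial k g) (h x) +
   \sum_k ('D_u (partial j h) x) 0 k *: partial k g (h x).
  have <- := near_eq_derive u (near_partial_comp j dh dg).
  rewrite (@derive_sum_scale _ _ _ _ (partial j h) (fun k => partial k g \o h)).
  - rewrite -big_split; apply: eq_bigr => k _.
    by apply: congr2; [apply: congr1; exact: Dgh|].
  - exact: dh.2.
  - by move=> k; apply: differentiable_comp => //; apply: dg.2.
rewrite (hess_partial _ (twice_differentiable_comp dh dg)).
under eq_bigr do rewrite Dj scalerDr.
rewrite big_split [RHS]addrC; apply: congr2; last first.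
  rewrite (hess_partial _ dh) jacobian_partial//.
  under eq_bigr do rewrite scaler_sumr.
  rewrite exchange_big; apply: eq_bigr => k _.
  rewrite summxE scaler_suml; apply: eq_bigr => j _.
  by rewrite mxE scalerA.
rewrite (hess_partial _ dg) (jacobian_partial _ dhx).
under eq_bigr do rewrite scaler_sumr.
rewrite exchange_big; apply: eq_bigr => k _.
rewrite [in RHS]summxE scaler_suml; apply: eq_bigr => j _.
by rewrite mxE scalerA.
Qed.

Lemma jacobian_comp0 (R : realType) n m p
    (h : 'rV[R]_n -> 'rV[R]_m) (g : 'rV[R]_m -> 'rV[R]_p) :
  twice_differentiable h 0 -> h 0 = 0 -> twice_differentiable g 0 ->
  'J (g \o h) 0 = 'J h 0 *m 'J g 0.
Proof.
move=> /twice_differentiable_at dh h0 /twice_differentiable_at dg.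
have dg' : differentiable g (h 0) by rewrite h0.
by rewrite (jacobian_comp dh dg') h0.
Qed.

Lemma hess_comp0 (R : realType) n m p
    (h : 'rV[R]_n -> 'rV[R]_m) (g : 'rV[R]_m -> 'rV[R]_p) (u : 'rV[R]_n) :
  twice_differentiable h 0 -> h 0 = 0 -> twice_differentiable g 0 ->
  hess (g \o h) 0 u = hess h 0 u *m 'J g 0 + hess g 0 (u *m 'J h 0).
Proof.
move=> dh h0 dg; have dg' : twice_differentiable g (h 0) by rewrite h0.
by rewrite (hess_comp u dh dg') h0.
Qed.

Lemma hessD (R : realType) n m (f g : 'rV[R]_n -> 'rV[R]_m) (x u : 'rV[R]_n) :
  twice_differentiable f x -> twice_differentiable g x ->
  hess (f + g) x u = hess f x u + hess g x u.
Proof.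
move=> df dg; rewrite /hess -big_split; apply: eq_bigr => i _.
rewrite -big_split; apply: eq_bigr => j _ /=; rewrite -scalerDr; congr (_ *: _).
rewrite -deriveD; [|exact/diff_derivable/(df.2 j)|exact/diff_derivable/(dg.2 j)].
apply: near_eq_derive; have [dfx _] := df; have [dgx _] := dg; near=> y.
rewrite /partial [LHS]deriveD//; apply: diff_derivable; near: y.
  exact: dfx.
exact: dgx.
Unshelve. all: by end_near. Qed.

Lemma jet2E (R : realType) n m (f : 'rV[R]_n -> 'rV[R]_m) :
  differentiable f 0 ->
  jet2 f = fun u => f 0 + u *m 'J f 0 + 2^-1 *: hess f 0 u.
Proof. by move=> df; apply/funext => u; rewrite /jet2 jacobian_partial. Qed.

Lemma hessZ (R : realType) n m (f : 'rV[R]_n -> 'rV[R]_m) (x u : 'rV[R]_n) a :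
  hess f x (a *: u) = a ^+ 2 *: hess f x u.
Proof.
rewrite /hess scaler_sumr; apply: eq_bigr => i _.
rewrite scaler_sumr; apply: eq_bigr => j _.
by rewrite !mxE scalerA; congr (_ *: _); rewrite mulrACA -expr2.
Qed.

(** The value at [0], the odd part and the even part of a polynomial map of
    degree two are its three homogeneous components. *)
Lemma poly2_inj (R : numFieldType) n m (c d : 'rV[R]_m) (A B : 'M[R]_(n, m))
    (p q : 'rV[R]_n -> 'rV[R]_m) :
  (forall a u, p (a *: u) = a ^+ 2 *: p u) ->
  (forall a u, q (a *: u) = a ^+ 2 *: q u) ->
  (fun u => c + u *m A + 2^-1 *: p u) = (fun u => d + u *m B + 2^-1 *: q u) ->
  [/\ c = d, A = B & p =1 q].
Proof.
move=> hp hq pq.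
have p0 : p 0 = 0 by rewrite -[X in p X](scale0r 0) hp expr0n scale0r.
have q0 : q 0 = 0 by rewrite -[X in q X](scale0r 0) hq expr0n scale0r.
have pN u : p (- u) = p u by rewrite -scaleN1r hp sqrrN expr1n scale1r.
have qN u : q (- u) = q u by rewrite -scaleN1r hq sqrrN expr1n scale1r.
have cd : c = d.
  have := congr1 (fun F => F 0) pq.
  by rewrite /= !mul0mx p0 q0 !scaler0 !addr0.
have pqu u : u *m A + 2^-1 *: p u = u *m B + 2^-1 *: q u.
  by have := congr1 (fun F => F u) pq; rewrite /= cd -!addrA => /addrI.
have pqN u : - (u *m A) + 2^-1 *: p u = - (u *m B) + 2^-1 *: q u.
  by have := pqu (- u); rewrite !mulNmx pN qN.
have inj2 (a b : 'rV[R]_m) : a + a = b + b -> a = b.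
  have two0 : 2 != 0 :> R by rewrite pnatr_eq0.
  by move=> ab; apply: (scalerI two0); rewrite !scaler_nat !mulr2n.
split=> // [|u].
  apply/row_matrixP => i; rewrite !rowE; apply: inj2.
  have := congr2 (fun a b => a - b) (pqu (delta_mx 0 i)) (pqN (delta_mx 0 i)).
  by rewrite /= !opprD !opprK !addrA !(addrAC _ (2^-1 *: _)) !subrK.
have := congr2 +%R (pqu u) (pqN u).
rewrite [LHS]addrACA [RHS]addrACA !subrr !add0r => /inj2.
by apply: scalerI; rewrite invr_eq0 pnatr_eq0.
Qed.

(** Equality of 2-jets is thus equality of values, Jacobians and quadratic
    parts, which is the form in which the chain rule applies. *)
Lemma jet2_inj (R : realType) n m (f g : 'rV[R]_n -> 'rV[R]_m) :
  differentiable f 0 -> differentiable g 0 ->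
  jet2 f = jet2 g <->
  [/\ f 0 = g 0, 'J f 0 = 'J g 0 & hess f 0 =1 hess g 0].
Proof.
move=> df dg; rewrite (jet2E df) (jet2E dg); split=> [fg|[f0 J H]].
  by apply: poly2_inj fg => a u; apply: hessZ.
by apply/funext => u; rewrite f0 J H.
Qed.

(** A2-equivalence depends on the diffeomorphisms only through their
    derivatives of order one and two. *)
Lemma A2_equivP (R : realType) n m (f g : 'rV[R]_n -> 'rV[R]_m) :
  twice_differentiable f 0 -> f 0 = 0 -> twice_differentiable g 0 -> g 0 = 0 ->
  A2_equiv f g <->
  exists psi Phi, [/\ diffeo_germ psi, diffeo_germ Phi,
    'J psi 0 *m 'J f 0 *m 'J Phi 0 = 'J g 0 &
    forall u, hess psi 0 u *m ('J f 0 *m 'J Phi 0) +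
              (hess f 0 (u *m 'J psi 0) *m 'J Phi 0 +
               hess Phi 0 (u *m 'J psi 0 *m 'J f 0)) = hess g 0 u].
Proof.
move=> df f0 dg g0.
have main psi Phi : diffeo_germ psi -> diffeo_germ Phi ->
  jet2 (Phi \o f \o psi) = jet2 g <->
    ('J psi 0 *m 'J f 0 *m 'J Phi 0 = 'J g 0) /\
    (forall u, hess psi 0 u *m ('J f 0 *m 'J Phi 0) +
              (hess f 0 (u *m 'J psi 0) *m 'J Phi 0 +
               hess Phi 0 (u *m 'J psi 0 *m 'J f 0)) = hess g 0 u).
  move=> [psi0 /smooth_twice_differentiable dpsi _].
  move=> [Phi0 /smooth_twice_differentiable dPhi _].
  have dPf : twice_differentiable (Phi \o f) 0.
    by apply: twice_differentiable_comp => //; rewrite f0.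
  have dF : twice_differentiable (Phi \o f \o psi) 0.
    by apply: twice_differentiable_comp => //; rewrite psi0.
  have Pf0 : (Phi \o f) 0 = 0 by rewrite /= f0.
  rewrite (jet2_inj (twice_differentiable_at dF) (twice_differentiable_at dg)).
  rewrite (jacobian_comp0 dpsi psi0 dPf) (jacobian_comp0 df f0 dPhi) mulmxA.
  have H u : hess (Phi \o f \o psi) 0 u =
      hess psi 0 u *m ('J f 0 *m 'J Phi 0) +
      (hess f 0 (u *m 'J psi 0) *m 'J Phi 0 +
       hess Phi 0 (u *m 'J psi 0 *m 'J f 0)).
    apply: (etrans (hess_comp0 u dpsi psi0 dPf)).
    by rewrite (jacobian_comp0 df f0 dPhi) (hess_comp0 (u *m 'J psi 0) df f0 dPhi).
  split=> [[_ JF HF]|[JF HF]]; split.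
  - exact: JF.
  - by move=> u; apply: etrans (HF u); rewrite H.
  - by rewrite /= psi0 f0 Phi0 g0.
  - exact: JF.
  - by move=> u; apply: etrans (HF u); rewrite H.
split=> -[psi [Phi [Dpsi DPhi]]].
  by move=> /(main _ _ Dpsi DPhi)[J H]; exists psi, Phi; split.
move=> J H; exists psi, Phi; split; [exact: Dpsi|exact: DPhi|].
by apply/(main _ _ Dpsi DPhi); split.
Qed.

(** * Quadratic maps *)

(** Nested like a Horner scheme, so that differentiating it uses only the product
    rule for a coordinate times an affine map; [quadmapE] gives the expanded form. *)
Definition quadmap (R : realType) n m (c : 'rV[R]_m) (L : 'M[R]_(n, m))
    (Q : 'I_n -> 'I_n -> 'rV[R]_m) (u : 'rV[R]_n) : 'rV[R]_m :=
  c + \sum_i u 0 i *: (row i L + \sum_j u 0 j *: Q i j).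

Lemma differentiable_sum_coord (R : realType) n p
    (b : 'I_n -> 'rV[R]_n -> 'rV[R]_p) (x : 'rV[R]_n) :
  (forall k, differentiable (b k) x) ->
  differentiable (fun y : 'rV[R]_n => \sum_k y 0 k *: b k y) x.
Proof. by move=> db; apply: (@differentiable_sum_scale _ _ _ _ id b). Qed.

Lemma derive_sum_coord (R : realType) n p
    (b : 'I_n -> 'rV[R]_n -> 'rV[R]_p) (x v : 'rV[R]_n) :
  (forall k, differentiable (b k) x) ->
  'D_v (fun y : 'rV[R]_n => \sum_k y 0 k *: b k y) x =
  \sum_k (x 0 k *: 'D_v (b k) x + v 0 k *: b k x).
Proof.
move=> db; have := @derive_sum_scale _ _ _ _ id b x v _ db.
by rewrite derive_id; apply.
Qed.

Lemma differentiable_cstD (R : realType) (V W : normedModType R) (c : W)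
    (f : V -> W) (x : V) :
  differentiable f x -> differentiable (fun u => c + f u) x.
Proof. by move=> df; apply: (@differentiableD _ _ _ (cst c) f). Qed.

Lemma derive_cstD (R : realType) (V W : normedModType R) (c : W)
    (f : V -> W) (x v : V) :
  differentiable f x -> 'D_v (fun u => c + f u) x = 'D_v f x.
Proof.
move=> df; have := @deriveD _ _ _ (cst c) f x v _ (diff_derivable df).
by rewrite derive_cst add0r; apply.
Qed.

Lemma differentiable_affine_row (R : realType) n p (c : 'rV[R]_p)
    (q : 'I_n -> 'rV[R]_p) (x : 'rV[R]_n) :
  differentiable (fun u : 'rV[R]_n => c + \sum_j u 0 j *: q j) x.
Proof.
apply: differentiable_cstD.
by apply: (@differentiable_sum_coord _ _ _ (fun j => cst (q j))).
Qed.

Lemma derive_affine_row (R : realType) n p (c : 'rV[R]_p)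
    (q : 'I_n -> 'rV[R]_p) (x v : 'rV[R]_n) :
  'D_v (fun u : 'rV[R]_n => c + \sum_j u 0 j *: q j) x = \sum_j v 0 j *: q j.
Proof.
rewrite derive_cstD; last first.
  by apply: (@differentiable_sum_coord _ _ _ (fun j => cst (q j))).
rewrite (@derive_sum_coord _ _ _ (fun j => cst (q j)))//.
by apply: eq_bigr => j _; rewrite derive_cst scaler0 add0r.
Qed.

Lemma differentiable_quadmap (R : realType) n m (c : 'rV[R]_m)
    (L : 'M[R]_(n, m)) (Q : 'I_n -> 'I_n -> 'rV[R]_m) (x : 'rV[R]_n) :
  differentiable (quadmap c L Q) x.
Proof.
apply: differentiable_cstD; apply: differentiable_sum_coord => k.
exact: differentiable_affine_row.
Qed.

(** The directional derivatives of a quadratic map are again quadratic maps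
    (with zero quadratic part), which gives smoothness by induction. *)
Lemma derive_quadmap (R : realType) n m (c : 'rV[R]_m)
    (L : 'M[R]_(n, m)) (Q : 'I_n -> 'I_n -> 'rV[R]_m) (v x : 'rV[R]_n) :
  'D_v (quadmap c L Q) x =
  quadmap (v *m L)
    (\matrix_k \sum_i v 0 i *: (Q i k + Q k i)) (fun _ _ => 0) x.
Proof.
have da k (x : 'rV[R]_n) := differentiable_affine_row (row k L) (Q k) x.
rewrite derive_cstD; last exact: differentiable_sum_coord.
rewrite derive_sum_coord//.
under eq_bigr do rewrite derive_affine_row scalerDr addrCA.
rewrite /quadmap mulmx_sum_row big_split; congr (_ + _) => /=.
have z0 : \sum_j x 0 j *: (0 : 'rV[R]_m) = 0 by apply: big1 => j _; rewrite scaler0.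
under [RHS]eq_bigr do rewrite rowK z0 addr0 scaler_sumr.
under eq_bigr do rewrite !scaler_sumr.
rewrite big_split /= [X in _ + X]exchange_big -big_split; apply: eq_bigr => i _.
rewrite -big_split; apply: eq_bigr => j _ /=.
by rewrite addrC !scalerDr !scalerA [x 0 i * _]mulrC.
Qed.

Lemma smooth_quadmap (R : realType) n m (c : 'rV[R]_m)
    (L : 'M[R]_(n, m)) (Q : 'I_n -> 'I_n -> 'rV[R]_m) U :
  smooth_on U (quadmap c L Q).
Proof.
move=> k; elim: k c L Q => [|k IH] c L Q /=.
  by move=> x _; apply/differentiable_continuous/differentiable_quadmap.
split=> [x _|v]; first exact: differentiable_quadmap.
by rewrite (funext (derive_quadmap c L Q v)); exact: IH.
Qed.

Lemma smooth_germ_quadmap (R : realType) n m (c : 'rV[R]_m)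
    (L : 'M[R]_(n, m)) (Q : 'I_n -> 'I_n -> 'rV[R]_m) :
  smooth_germ (quadmap c L Q).
Proof. by exists setT; split=> //; [exact: openT|exact: smooth_quadmap]. Qed.

Lemma partial_quadmap (R : realType) n m (c : 'rV[R]_m)
    (L : 'M[R]_(n, m)) (Q : 'I_n -> 'I_n -> 'rV[R]_m) i (u : 'rV[R]_n) :
  partial i (quadmap c L Q) u = row i L + \sum_k u 0 k *: (Q i k + Q k i).
Proof.
rewrite /partial derive_quadmap /quadmap -rowE; congr (_ + _).
apply: eq_bigr => k _; rewrite big1 => [|? _]; last by rewrite scaler0.
rewrite addr0 rowK (bigD1 i)//= big1 => [|j ji]; last by rewrite mxE (negPf ji) andbF scale0r.
by rewrite !mxE !eqxx scale1r addr0.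
Qed.

Lemma partial2_quadmap (R : realType) n m (c : 'rV[R]_m)
    (L : 'M[R]_(n, m)) (Q : 'I_n -> 'I_n -> 'rV[R]_m) i j (u : 'rV[R]_n) :
  partial i (partial j (quadmap c L Q)) u = Q i j + Q j i.
Proof.
rewrite [partial j _](funext (derive_quadmap c L Q _)) partial_quadmap rowK.
rewrite [X in _ + X]big1 => [|k _]; last by rewrite addr0 scaler0.
rewrite addr0 (bigD1 j)//= big1 => [|k kj]; last by rewrite mxE (negPf kj) andbF scale0r.
by rewrite !mxE !eqxx scale1r addr0 addrC.
Qed.

Lemma hess_quadmap (R : realType) n m (c : 'rV[R]_m)
    (L : 'M[R]_(n, m)) (Q : 'I_n -> 'I_n -> 'rV[R]_m) (x u : 'rV[R]_n) :
  hess (quadmap c L Q) x u = 2 *: \sum_i \sum_j (u 0 i * u 0 j) *: Q i j.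
Proof.
rewrite /hess; under eq_bigr do under eq_bigr do rewrite partial2_quadmap scalerDr.
under eq_bigr do rewrite big_split.
rewrite big_split /= [X in _ + X]exchange_big scaler_nat mulr2n; congr (_ + _).
by apply: eq_bigr => i _; apply: eq_bigr => j _; rewrite mulrC.
Qed.

Lemma jacobian_quadmap0 (R : realType) n m (c : 'rV[R]_m)
    (L : 'M[R]_(n, m)) (Q : 'I_n -> 'I_n -> 'rV[R]_m) :
  'J (quadmap c L Q) 0 = L.
Proof.
apply/row_matrixP => i; rewrite row_jacobian; last exact: differentiable_quadmap.
by rewrite partial_quadmap big1 ?addr0// => k _; rewrite mxE scale0r.
Qed.

Lemma quadmap0 (R : realType) n m (c : 'rV[R]_m)
    (L : 'M[R]_(n, m)) (Q : 'I_n -> 'I_n -> 'rV[R]_m) : quadmap c L Q 0 = c.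
Proof. by rewrite /quadmap big1 ?addr0// => k _; rewrite mxE scale0r. Qed.

Lemma quadmapE (R : realType) n m (c : 'rV[R]_m)
    (L : 'M[R]_(n, m)) (Q : 'I_n -> 'I_n -> 'rV[R]_m) u :
  quadmap c L Q u = c + u *m L + \sum_i \sum_j (u 0 i * u 0 j) *: Q i j.
Proof.
rewrite /quadmap mulmx_sum_row -addrA; congr (_ + _).
rewrite -big_split; apply: eq_bigr => i _; rewrite scalerDr; congr (_ + _).
by rewrite scaler_sumr; apply: eq_bigr => j _; rewrite scalerA.
Qed.

(** Quadratic maps whose quadratic part is the product of a linear form and a
    linear map.  This covers the normal forms of the jets, linear maps, and
    enough quadratic diffeomorphisms. *)
Definition linquad (R : realType) n m (T : 'M[R]_(n, m)) (a : 'cV[R]_n)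
    (b : 'M[R]_(n, m)) (u : 'rV[R]_n) : 'rV[R]_m :=
  u *m T + (u *m a) 0 0 *: (u *m b).

Lemma linquad_quadmap (R : realType) n m (T : 'M[R]_(n, m)) (a : 'cV[R]_n)
    (b : 'M[R]_(n, m)) :
  linquad T a b = quadmap 0 T (fun i j => a i 0 *: row j b).
Proof.
apply/funext => u; rewrite quadmapE add0r; congr (_ + _).
rewrite mxE scaler_suml; apply: eq_bigr => i _.
rewrite [u *m b]mulmx_sum_row scaler_sumr; apply: eq_bigr => j _.
by rewrite !scalerA mulrAC.
Qed.

Lemma smooth_germ_linquad (R : realType) n m (T : 'M[R]_(n, m)) (a : 'cV[R]_n)
    (b : 'M[R]_(n, m)) : smooth_germ (linquad T a b).
Proof. by rewrite linquad_quadmap; apply: smooth_germ_quadmap. Qed.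

Lemma linquad0 (R : realType) n m (T : 'M[R]_(n, m)) (a : 'cV[R]_n)
    (b : 'M[R]_(n, m)) : linquad T a b 0 = 0.
Proof. by rewrite linquad_quadmap quadmap0. Qed.

Lemma jacobian_linquad0 (R : realType) n m (T : 'M[R]_(n, m)) (a : 'cV[R]_n)
    (b : 'M[R]_(n, m)) : 'J (linquad T a b) 0 = T.
Proof. by rewrite linquad_quadmap jacobian_quadmap0. Qed.

Lemma hess_linquad (R : realType) n m (T : 'M[R]_(n, m)) (a : 'cV[R]_n)
    (b : 'M[R]_(n, m)) u :
  hess (linquad T a b) 0 u = 2 *: ((u *m a) 0 0 *: (u *m b)).
Proof.
rewrite linquad_quadmap hess_quadmap; congr (_ *: _).
rewrite mxE scaler_suml; apply: eq_bigr => i _.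
rewrite [u *m b]mulmx_sum_row scaler_sumr; apply: eq_bigr => j _.
by rewrite !scalerA mulrAC.
Qed.

Lemma mulmxr_differentiable (R : realType) n m (T : 'M[R]_(n, m)) (x : 'rV[R]_n) :
  differentiable (fun x : 'rV[R]_n => x *m T) x.
Proof.
have -> : (fun x : 'rV[R]_n => x *m T) = linquad T 0 0.
  by apply/funext => y; rewrite /linquad !mulmx0 scaler0 addr0.
by rewrite linquad_quadmap; exact: differentiable_quadmap.
Qed.

(** The quadratic term [(u a) (u b)] takes its values, after [invmx T], where
    both the form [a] and the map [b] vanish; so it can be subtracted again. *)
Lemma linquadK (R : realType) n (T : 'M[R]_n) (a : 'cV[R]_n) (b : 'M[R]_n) :
  T \in unitmx -> b *m invmx T *m a = 0 -> b *m invmx T *m b = 0 ->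
  cancel (linquad T a b)
         (linquad (invmx T) (- (invmx T *m a)) (invmx T *m b *m invmx T)).
Proof.
move=> uT ba bb u; rewrite {1}/linquad !mulmxN !mulmxA.
set w := linquad T a b u *m invmx T.
have wE : w = u + (u *m a) 0 0 *: (u *m (b *m invmx T)).
  by rewrite /w mulmxDl mulmxK// -scalemxAl mulmxA.
have wa : w *m a = u *m a.
  by rewrite wE mulmxDl -scalemxAl -mulmxA ba mulmx0 scaler0 addr0.
have wb : w *m b = u *m b.
  by rewrite wE mulmxDl -scalemxAl -(mulmxA u) bb mulmx0 scaler0 addr0.
by rewrite wa wb {1}wE [fun_of_matrix (- _) _ _]mxE scaleNr -(mulmxA u) addrK.
Qed.

Lemma linquadKV (R : realType) n (T : 'M[R]_n) (a : 'cV[R]_n) (b : 'M[R]_n) :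
  T \in unitmx -> b *m invmx T *m a = 0 -> b *m invmx T *m b = 0 ->
  cancel (linquad (invmx T) (- (invmx T *m a)) (invmx T *m b *m invmx T))
         (linquad T a b).
Proof.
move=> uT ba bb w; set v := w *m invmx T; set x := linquad _ _ _ w.
have xE : x = v - (v *m a) 0 0 *: (v *m (b *m invmx T)).
  rewrite /x /linquad !mulmxN !mulmxA -/v.
  by rewrite [fun_of_matrix (- _) _ _]mxE scaleNr.
have xa : x *m a = v *m a.
  by rewrite xE mulmxBl -scalemxAl -(mulmxA v) ba mulmx0 scaler0 subr0.
have xb : x *m b = v *m b.
  by rewrite xE mulmxBl -scalemxAl -(mulmxA v) bb mulmx0 scaler0 subr0.
have vbT : v *m (b *m invmx T) *m T = v *m b by rewrite mulmxA mulmxKV.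
by rewrite /linquad xa xb xE mulmxBl -scalemxAl vbT subrK mulmxKV.
Qed.

Lemma diffeo_linquad (R : realType) n (T : 'M[R]_n) (a : 'cV[R]_n)
    (b : 'M[R]_n) :
  T \in unitmx -> b *m invmx T *m a = 0 -> b *m invmx T *m b = 0 ->
  diffeo_germ (linquad T a b).
Proof.
move=> uT ba bb; split; [exact: linquad0|exact: smooth_germ_linquad|].
exists (linquad (invmx T) (- (invmx T *m a)) (invmx T *m b *m invmx T)).
split; [exact: linquad0|exact: smooth_germ_linquad| |]; apply: filterE => u.
- exact: linquadK.
- exact: linquadKV.
Qed.

(** * Matrices up to column operations and row operations fixing the last row *)

(** The action on matrices of the linear parts of the changes of
    coordinates: [T] acts on the normal space, and [P] is a change of source whose
    last row is that of the identity, so that it fixes the kernel of [df_0]. *)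
Definition flag_equiv (F : fieldType) m p (N N' : 'M[F]_(m + 1, p)) : Prop :=
  exists (P : 'M[F]_(m + 1)) (T : 'M[F]_p),
    [/\ P \in unitmx, T \in unitmx, row_mx 0 1%:M *m P = row_mx 0 1%:M
      & P *m N *m T = N'].

Lemma flag_equiv_sym (F : fieldType) m p (N N' : 'M[F]_(m + 1, p)) :
  flag_equiv N N' -> flag_equiv N' N.
Proof.
move=> [P [T [uP uT eP <-]]]; exists (invmx P), (invmx T).
by rewrite !unitmx_inv; split=> //; [rewrite -{1}eP mulmxK|
  rewrite -!mulmxA mulKmx// mulmxV// mulmx1].
Qed.

Lemma flag_equiv_trans (F : fieldType) m p (N2 N1 N3 : 'M[F]_(m + 1, p)) :
  flag_equiv N1 N2 -> flag_equiv N2 N3 -> flag_equiv N1 N3.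
Proof.
move=> [P [T [uP uT eP <-]]] [P' [T' [uP' uT' eP' <-]]].
exists (P' *m P), (T *m T'); rewrite !unitmx_mul uP uT uP' uT'; split=> //.
  by rewrite mulmxA eP' eP.
by rewrite !mulmxA.
Qed.

(** When the last row vanishes, only the first [m] rows matter, and they can be
    reduced to the standard matrix of their rank. *)
Lemma flag_equiv_deg (F : fieldType) m p (N : 'M[F]_(m + 1, p)) :
  row_mx 0 1%:M *m N = 0 -> flag_equiv N (col_mx (pid_mx (\rank N)) 0).
Proof.
rewrite -[N]vsubmxK mul_row_col mul0mx add0r mul1mx => ->.
set N1 := usubmx N; rewrite rank_col_mx0.
exists (block_mx (invmx (col_ebase N1)) 0 0 1%:M), (invmx (row_ebase N1)).
split.
- by rewrite unitmxE det_lblock det1 mulr1 -unitmxE unitmx_inv col_ebase_unit.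
- by rewrite unitmx_inv row_ebase_unit.
- by rewrite mul_row_block !mul0mx !mulmx0 !mul1mx !add0r.
rewrite mul_block_col !mulmx0 !mul0mx !addr0 mul_col_mx mul0mx.
rewrite -{2}(mulmx_ebase N1) -!mulmxA mulKmx ?col_ebase_unit//.
by rewrite mulmxV ?row_ebase_unit// mulmx1.
Qed.

Lemma row_completion (F : fieldType) p (a : 'rV[F]_(1 + p)) : a != 0 ->
  exists2 T : 'M[F]_(1 + p), T \in unitmx & a *m T = row_mx 1%:M 0.
Proof.
move=> a0; have ra : \rank a = 1%N by rewrite rank_rV a0.
pose c := col_ebase a 0 0.
have c0 : c != 0 by have := col_ebase_unit a; rewrite unitmxE det_mx11 unitfE.
exists (c^-1 *: invmx (row_ebase a)).
  by rewrite unitmxZ ?unitfE ?invr_eq0// unitmx_inv row_ebase_unit.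
rewrite -scalemxAr -{1}(mulmx_ebase a) mulmxK ?row_ebase_unit//.
rewrite [col_ebase a]mx11_scalar -/c mul_scalar_mx scalerA mulVf// scale1r ra.
by rewrite pid_mx_row.
Qed.

Lemma rank_antidiag (F : fieldType) m p (X : 'M[F]_(m, p)) :
  \rank (block_mx 0 X 1%:M 0 : 'M[F]_(m + 1, 1 + p)) = (\rank X).+1.
Proof.
have free : row_free (block_mx 0 1%:M 1%:M 0 : 'M[F]_(1 + p, p + 1)).
  apply/row_freeP; exists (block_mx 0 1%:M 1%:M 0).
  by rewrite mulmx_block !mul0mx !mulmx0 !mulmx1 !addr0 !add0r -scalar_mx_block.
rewrite -(mxrankMfree _ free) mulmx_block !mul0mx !mulmx0 !mulmx1 !addr0 !add0r.
by rewrite rank_diag_block_mx mxrank1 addn1.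
Qed.

Lemma mxrank_mul_unit (F : fieldType) m p (P : 'M[F]_m) (T : 'M[F]_p)
    (N : 'M[F]_(m, p)) :
  P \in unitmx -> T \in unitmx -> \rank (P *m N *m T) = \rank N.
Proof.
move=> uP uT; rewrite mxrankMfree ?row_free_unit//.
by rewrite eqmxMfull// row_full_unit.
Qed.

Lemma flag_equiv_rank (F : fieldType) m p (N N' : 'M[F]_(m + 1, p)) :
  flag_equiv N N' -> \rank N' = \rank N.
Proof. by move=> [P [T [uP uT _ <-]]]; apply: mxrank_mul_unit. Qed.

(** A nonzero last row can be completed to a basis; subtracting multiples
    of it clears the first column of the other rows, and what remains is an
    unconstrained block of rank one less. *)
Lemma flag_equiv_nondeg (F : fieldType) m p (N : 'M[F]_(m + 1, 1 + p)) :
  row_mx 0 1%:M *m N != 0 ->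
  flag_equiv N (block_mx 0 (pid_mx (\rank N).-1) 1%:M 0).
Proof.
move=> /row_completion[T1 uT1 aT1].
pose N1 := N *m T1; pose v := ulsubmx N1; pose X := ursubmx N1.
have N1E : N1 = block_mx v X 1%:M 0.
  have : row_mx 0 1%:M *m N1 = row_mx 1%:M 0 by rewrite mulmxA.
  rewrite -{1}[N1]submxK mul_row_block !mul0mx !add0r !mul1mx => /eq_row_mx[dl dr].
  by rewrite -[LHS]submxK dl dr.
have step1 : flag_equiv N (block_mx 0 X 1%:M 0).
  exists (block_mx 1%:M (- v) 0 1%:M), T1; split=> //.
  - by rewrite unitmxE det_ublock !det1 mulr1 unitr1.
  - by rewrite mul_row_block !mul0mx !mulmx0 !mul1mx !add0r.
  rewrite -mulmxA -/N1 N1E mulmx_block !mul0mx !mulmx0 !mul1mx !mulmx1.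
  by rewrite subrr !addr0 !add0r.
have rX : (\rank N).-1 = \rank X.
  by rewrite -(flag_equiv_rank step1) rank_antidiag.
rewrite rX; apply: flag_equiv_trans step1 _.
exists (block_mx (invmx (col_ebase X)) 0 0 1%:M),
       (block_mx 1%:M 0 0 (invmx (row_ebase X))); split.
- by rewrite unitmxE det_lblock det1 mulr1 -unitmxE unitmx_inv col_ebase_unit.
- by rewrite unitmxE det_lblock det1 mul1r -unitmxE unitmx_inv row_ebase_unit.
- by rewrite mul_row_block !mul0mx !mulmx0 !mul1mx !add0r.
rewrite !mulmx_block !mul0mx !mulmx0 !mul1mx !mulmx1 !addr0 !add0r !mul0mx.
congr block_mx.
rewrite -{2}(mulmx_ebase X) -!mulmxA mulKmx ?col_ebase_unit//.
by rewrite mulmxV ?row_ebase_unit// mulmx1.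
Qed.

(** The rank and the vanishing of the last row determine a canonical form,
    hence are complete invariants. *)
Lemma flag_equivP (F : fieldType) m p (N N' : 'M[F]_(m + 1, 1 + p)) :
  \rank N = \rank N' ->
  (row_mx 0 1%:M *m N == 0) = (row_mx 0 1%:M *m N' == 0) ->
  flag_equiv N N'.
Proof.
move=> rN; case: eqVneq => [N0 /esym/eqP N'0|N0 /esym/negbT N'0].
  apply: flag_equiv_trans (flag_equiv_deg N0) _; rewrite rN.
  exact: flag_equiv_sym (flag_equiv_deg N'0).
apply: flag_equiv_trans (flag_equiv_nondeg N0) _; rewrite rN.
exact: flag_equiv_sym (flag_equiv_nondeg N'0).
Qed.

(** * Normal forms of 2-jets of corank one *)

(** The direction of the kernel of [df_0], the last coordinate axis. *)
Definition kervec (R : pzRingType) m : 'rV[R]_(m + 1) := row_mx 0 1%:M.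

(** The Jacobian of the normal forms: it forgets the last coordinate of the
    source, and its rows span the tangent space. *)
Definition tangent_mx (R : pzRingType) m p : 'M[R]_(m + 1, m + p) :=
  block_mx 1%:M 0 0 0.

(** The inclusion of the last [p] coordinates, whose rows span the normal space. *)
Definition normal_mx (R : pzRingType) m p : 'M[R]_(p, m + p) := row_mx 0 1%:M.

Lemma kervec_tangent_mx (R : pzRingType) m p : kervec R m *m tangent_mx R m p = 0.
Proof. by rewrite mul_row_block !mulmx0 !mul0mx !addr0 row_mx0. Qed.

Lemma kervec_tr (R : pzRingType) m : kervec R m *m (kervec R m)^T = 1%:M.
Proof. by rewrite tr_row_mx mul_row_col trmx1 mulmx1 mul0mx add0r. Qed.

Lemma tangent_mx_normal_mx (R : pzRingType) m p : tangent_mx R m p *m (normal_mx R m p)^T = 0.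
Proof.
by rewrite tr_row_mx mul_block_col trmx1 trmx0 !mulmx0 !mul0mx !addr0 col_mx0.
Qed.

Lemma normal_mx_tangent_mx (R : comPzRingType) m p : normal_mx R m p *m (tangent_mx R m p)^T = 0.
Proof. by rewrite -[normal_mx R m p]trmxK -trmx_mul tangent_mx_normal_mx trmx0. Qed.

Lemma normal_mx_tr (R : pzRingType) m p : normal_mx R m p *m (normal_mx R m p)^T = 1%:M.
Proof. by rewrite tr_row_mx mul_row_col trmx1 mulmx1 mul0mx add0r. Qed.

Lemma tangent_mx_tr (R : pzRingType) m p :
  tangent_mx R m p *m (tangent_mx R m p)^T = 1%:M - (kervec R m)^T *m kervec R m.
Proof.
rewrite tr_block_mx !trmx0 trmx1 mulmx_block tr_row_mx mul_col_row trmx1 trmx0.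
rewrite !mulmx0 !mul0mx !mulmx1 !addr0.
by rewrite [X in X - _]scalar_mx_block opp_block_mx add_block_mx !oppr0 !addr0 subrr.
Qed.

Lemma tangent_mx_normal_mx_id (R : pzRingType) m p :
  (tangent_mx R m p)^T *m tangent_mx R m p + (normal_mx R m p)^T *m normal_mx R m p = 1%:M.
Proof.
rewrite tr_block_mx !trmx0 trmx1 mulmx_block tr_row_mx mul_col_row trmx1 trmx0.
by rewrite !mulmx0 !mul0mx !mulmx1 !addr0 add_block_mx !addr0 !add0r -scalar_mx_block.
Qed.

Lemma mul_tangent_mx (R : pzRingType) m p (u : 'rV[R]_(m + 1)) :
  u *m tangent_mx R m p = row_mx (lsubmx u) 0.
Proof.
by rewrite -{1}[u]hsubmxK mul_row_block !mulmx1 !mulmx0 !addr0.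
Qed.

(** The quadratic part is the last coordinate of [u] times a linear map with
    values in the normal space. *)
Definition normal_jet (R : realType) m p (N : 'M[R]_(m + 1, p))
    (f : 'rV[R]_(m + 1) -> 'rV[R]_(m + p)) : Prop :=
  [/\ twice_differentiable f 0, f 0 = 0, 'J f 0 = tangent_mx R m p &
      forall u, hess f 0 u =
        2 *: ((u *m (kervec R m)^T) 0 0 *: (u *m (N *m normal_mx R m p)))].

Lemma normal_jet_linquad (R : realType) m p (N : 'M[R]_(m + 1, p)) :
  normal_jet N (linquad (tangent_mx R m p) (kervec R m)^T (N *m normal_mx R m p)).
Proof.
split; [|exact: linquad0|exact: jacobian_linquad0|exact: hess_linquad].
exact/smooth_twice_differentiable/smooth_germ_linquad.
Qed.

(** Terms of order three do not change the 2-jet; the hypothesis on [rho] is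
    read through the uniqueness of the homogeneous components of a polynomial. *)
Lemma normal_jet_perturbation (R : realType) m p (N : 'M[R]_(m + 1, p))
    (f q rho : 'rV[R]_(m + 1) -> 'rV[R]_(m + p)) :
  normal_jet N q -> twice_differentiable f 0 -> f 0 = 0 ->
  twice_differentiable rho 0 -> jet2 rho = (fun=> 0) ->
  (\forall u \near (0 : 'rV[R]_(m + 1)), f u = q u + rho u) -> normal_jet N f.
Proof.
move=> [dq q0 Jq Hq] df f0 drho jrho fE.
have [rho0 Jrho Hrho] : [/\ rho 0 = 0, 'J rho 0 = 0 & hess rho 0 =1 (fun=> 0)].
  apply: (@poly2_inj _ _ _ (rho 0) 0 ('J rho 0) 0 (hess rho 0) (fun=> 0)).
  - by move=> a u; exact: hessZ.
  - by move=> a u; rewrite scaler0.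
  - rewrite -(jet2E (twice_differentiable_at drho)) jrho; apply/funext => u.
    by rewrite mulmx0 scaler0 !addr0.
have dqx := twice_differentiable_at dq; have drx := twice_differentiable_at drho.
split; [exact: df|exact: f0| |].
  apply: etrans (eq_near_jacobian (twice_differentiable_at df) (differentiableD dqx drx) fE) _.
  by rewrite (jacobianD dqx drx) Jq Jrho addr0.
move=> u; apply: etrans (eq_near_hess u fE) _.
by apply: etrans (hessD u dq drho) _; rewrite Hq Hrho addr0.
Qed.

(** Polarising [z * (u *m N)] in the direction of the last axis differentiates
    the [z^2] term twice, which doubles the last row of [N]. *)
Definition double_last (R : pzRingType) m : 'M[R]_(m + 1) :=
  1%:M + (kervec R m)^T *m kervec R m.

Lemma kervec_double_last (R : pzRingType) m :
  kervec R m *m double_last R m = 2 *: kervec R m.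
Proof.
by rewrite mulmxDr mulmx1 mulmxA kervec_tr mul1mx scaler_nat mulr2n.
Qed.

Lemma double_last_unit (R : numFieldType) m : double_last R m \in unitmx.
Proof.
rewrite /double_last tr_row_mx mul_col_row trmx1 trmx0 !mulmx0 !mul0mx mulmx1.
rewrite scalar_mx_block add_block_mx !addr0 unitmxE det_lblock det1 mul1r.
by rewrite -mulr2n det_mx11 mulr2n !mxE unitfE -mulr2n pnatr_eq0.
Qed.

(** The matrix form of the invariance: [P] is the Jacobian of the change of
    source, [S] the action of the change of target on the quotient by the
    tangent space, and [l] the factor by which [P] acts on the kernel of [df_0]. *)
Lemma A2_equiv_normal_jet (R : realType) m p (N N' : 'M[R]_(m + 1, p))
    (f g : 'rV[R]_(m + 1) -> 'rV[R]_(m + p)) :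
  normal_jet N f -> normal_jet N' g -> A2_equiv f g ->
  exists (P : 'M[R]_(m + 1)) (S : 'M[R]_p) (l : R),
    [/\ P \in unitmx, S \in unitmx, l != 0, kervec R m *m P = l *: kervec R m &
        double_last R m *m N' = l *: (P *m double_last R m *m N *m S)].
Proof.
move=> [df f0 Jf Hf] [dg g0 Jg Hg] /(A2_equivP df f0 dg g0)[psi [Phi [Dpsi DPhi]]].
have uP := diffeo_jacobian_unit Dpsi; have uT := diffeo_jacobian_unit DPhi.
rewrite Jf Jg; set P := 'J psi 0 in uP *; set T := 'J Phi 0 in uT *.
move=> JE HE; set e := kervec R m; set E := tangent_mx R m p in JE HE.
set i := normal_mx R m p.
have PE : P *m E = E *m invmx T by apply: (canRL (mulmxK uT)).
have ET : E *m T = invmx P *m E by apply: (canRL (mulKmx uP)); rewrite mulmxA.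
(* The change of target preserves the tangent space. *)
have ETi : E *m T *m i^T = 0 by rewrite ET -mulmxA tangent_mx_normal_mx mulmx0.
have ePE : e *m P *m E = 0 by rewrite -mulmxA PE mulmxA kervec_tangent_mx mul0mx.
pose l := (e *m P *m e^T) 0 0.
have eP : e *m P = l *: e.
  rewrite -[LHS]mulmx1 -[1%:M](subrK (e^T *m e)) -(tangent_mx_tr R m p) mulmxDr !mulmxA ePE.
  by rewrite mul0mx add0r [e *m P *m e^T]mx11_scalar mul_scalar_mx.
have l0 : l != 0.
  apply/eqP => l0; move: eP; rewrite l0 scale0r => eP.
  have : e *m e^T = 0 by rewrite -[e](mulmxK uP) eP !mul0mx.
  by rewrite kervec_tr => /matrixP/(_ 0 0)/eqP; rewrite !mxE oner_eq0.
pose S := i *m T *m i^T.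
have uS : S \in unitmx.
  have /mulmx1_unit[] : S *m (i *m invmx T *m i^T) = 1%:M; last by [].
  rewrite /S -!mulmxA (mulmxA i^T) -[i^T *m i](addKr (E^T *m E)).
  rewrite tangent_mx_normal_mx_id mulmxDl mul1mx mulmxDr (mulmxA T (invmx T)) mulmxV// mul1mx.
  rewrite mulNmx mulmxN -!mulmxA (mulmxA E) -PE -mulmxA tangent_mx_normal_mx.
  by rewrite !mulmx0 oppr0 add0r normal_mx_tr.
have key u : 2 *: ((u *m P *m e^T) 0 0 *: (u *m P *m N *m S)) +
       hess Phi 0 (u *m P *m E) *m i^T = 2 *: ((u *m e^T) 0 0 *: (u *m N')).
  have := congr1 (mulmx^~ i^T) (HE u).
  rewrite /= !mulmxDl -(mulmxA _ (E *m T)) ETi mulmx0 add0r (Hf (u *m P)) (Hg u).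
  rewrite -!scalemxAl -(mulmxA u (N' *m i)) -(mulmxA N') normal_mx_tr mulmx1 => <-.
  by rewrite !mulmxA.
exists P, S, l; split=> //.
apply/row_matrixP => k; rewrite !rowE; move: (delta_mx 0 k) => u.
(* The term coming from the quadratic part of [Phi] takes the same value at
   [u + e] and [u - e], so it disappears from the difference of the two
   instances of [key]. *)
have add s : (u + s *: e) *m P *m E = u *m P *m E.
  by rewrite !mulmxDl -!scalemxAl ePE scaler0 addr0.
have addP s : (u + s *: e) *m P = u *m P + (s * l) *: e.
  by rewrite mulmxDl -scalemxAl eP scalerA.
have addc s (v : 'rV[R]_(m + 1)) : ((v + s *: e) *m e^T) 0 0 = (v *m e^T) 0 0 + s.
  by rewrite mulmxDl -scalemxAl kervec_tr !mxE eqxx mulr1.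
have DE (v : 'rV[R]_(m + 1)) (M : 'M[R]_(m + 1, p)) :
    v *m (double_last R m *m M) = v *m M + (v *m e^T) 0 0 *: (e *m M).
  rewrite mulmxA mulmxDr mulmx1 mulmxDl (mulmxA v) [v *m e^T]mx11_scalar.
  by rewrite mul_scalar_mx -scalemxAl [_%:M 0 0]mxE eqxx mulr1n.
have PD : P *m double_last R m *m N *m S = P *m (double_last R m *m (N *m S)).
  by rewrite !mulmxA.
have -> : u *m (l *: (P *m double_last R m *m N *m S)) =
   l *: (u *m P *m N *m S + (u *m P *m e^T) 0 0 *: (e *m N *m S)).
  by rewrite PD -scalemxAr mulmxA DE !(mulmxA _ N).
rewrite DE.
have := key (u + (-1) *: e); have := key (u + 1 *: e).
rewrite !add !addP !addc !mulmxDl -!scalemxAl; clearbody S.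
move: (u *m P *m N *m S) (e *m N *m S) (u *m N') (e *m N') => A a C c.
move: (u *m P *m e^T) (u *m e^T) (_ *m i^T) => x y H.
move=> kp km; apply/rowP => j; move: kp km => /rowP/(_ j) + /rowP/(_ j); rewrite !mxE.
lra.
Qed.

(** The change of source is the linear map [P].  Since [P] fixes the last
    basis vector, [u *m P] and [u] have the same last coordinate up to a linear
    form [u *m d] in the first coordinates, and the two quadratic parts then
    differ by the product of this form with the map [b]; both vanish on the
    kernel, so the product is a quadratic map of the tangent components that a
    quadratic change of target absorbs. *)
Lemma normal_jet_flag_equiv (R : realType) m p (N N' : 'M[R]_(m + 1, p))
    (f g : 'rV[R]_(m + 1) -> 'rV[R]_(m + p)) :
  normal_jet N f -> normal_jet N' g ->
  flag_equiv (double_last R m *m N) (double_last R m *m N') -> A2_equiv f g.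
Proof.
move=> [df f0 Jf Hf] [dg g0 Jg Hg] [P [T [uP uT eP PNT]]].
apply/(A2_equivP df f0 dg g0); rewrite Jf Jg {Jf Jg}.
set e := kervec R m; set E := tangent_mx R m p; set i := normal_mx R m p.
have {}eP : e *m P = e := eP.
have ePV : e *m invmx P = e by rewrite -{1}eP mulmxK.
have eE : e *m E = 0 := kervec_tangent_mx R m p.
have iE : i *m E^T = 0 := normal_mx_tangent_mx R m p.
have Ei : E *m i^T = 0 := tangent_mx_normal_mx R m p.
have EE : E *m E^T = 1%:M - e^T *m e := tangent_mx_tr R m p.
have ii : i *m i^T = 1%:M := normal_mx_tr R m p.
have EEii : E^T *m E + i^T *m i = 1%:M := tangent_mx_normal_mx_id R m p.
have ee : e *m e^T = 1%:M := kervec_tr R m.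
(* On the tangent space the change of target undoes [P]; on the normal space it
   is [T]. *)
pose Tm := E^T *m invmx P *m E + i^T *m T *m i.
pose Tm' := E^T *m P *m E + i^T *m invmx T *m i.
have PETm : P *m E *m Tm = E.
  rewrite mulmxDr !mulmxA -!(mulmxA P E) EE Ei mulmx0 !mul0mx addr0.
  rewrite mulmxBr mulmx1 !mulmxBl mulmxV// mul1mx -!mulmxA (mulmxA e) ePV eE.
  by rewrite !mulmx0 subr0.
have iTm : i *m Tm = T *m i.
  by rewrite mulmxDr !mulmxA iE ii !mul0mx add0r mul1mx.
have iTm' : i *m Tm' = invmx T *m i.
  by rewrite mulmxDr !mulmxA iE ii !mul0mx add0r mul1mx.
have ETm' : E *m Tm' = P *m E - e^T *m e *m E.
  rewrite mulmxDr !mulmxA EE Ei !mul0mx addr0 !mulmxBl mul1mx.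
  by rewrite -(mulmxA e^T e P) eP.
have TmTm' : Tm *m Tm' = 1%:M.
  rewrite mulmxDl -(mulmxA _ E) ETm' -(mulmxA e^T) eE mulmx0 subr0.
  rewrite -(mulmxA _ i) iTm' -(mulmxA E^T) (mulmxA (invmx P)) mulVmx// mul1mx.
  by rewrite -(mulmxA i^T) (mulmxA T) mulmxV// mul1mx.
have [uTm uTm'] := mulmx1_unit TmTm'.
have TmV : invmx Tm = Tm'.
  by rewrite -[LHS]mulmx1 -TmTm' mulKmx.
have iTmE : i *m invmx Tm *m E^T = 0.
  by rewrite TmV iTm' -mulmxA iE mulmx0.
pose d := P *m e^T - e^T.
pose b := P *m e^T *m e *m N' - N'.
have ed : e *m d = 0 by rewrite mulmxBr mulmxA eP subrr.
have eb : e *m b = 0.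
  by rewrite mulmxBr !mulmxA eP ee mul1mx subrr.
have PEd q (M : 'M[R]_(m + 1, q)) : e *m M = 0 ->
    P *m E *m (E^T *m invmx P *m M) = M.
  move=> eM; rewrite !mulmxA -(mulmxA P E) EE mulmxBr mulmx1 !mulmxBl mulmxV//.
  by rewrite mul1mx -!mulmxA (mulmxA e) ePV eM !mulmx0 subr0.
have z q (M : 'M[R]_(m + 1, q)) : E^T *m invmx P *m (b *m i) *m invmx Tm *m
    (E^T *m invmx P *m M) = 0.
  rewrite -(mulmxA E^T _ M) (mulmxA _ E^T) (mulmxA _ b) -(mulmxA _ i).
  by rewrite -(mulmxA _ (i *m _)) iTmE mulmx0 mul0mx.
exists (linquad P 0 0), (linquad Tm (E^T *m invmx P *m d) (E^T *m invmx P *m (b *m i))).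
split.
- by apply: diffeo_linquad => //; rewrite mulmx0.
- by apply: diffeo_linquad => //; apply: z.
- by rewrite !jacobian_linquad0.
move=> u; rewrite !jacobian_linquad0 !hess_linquad Hf Hg -/i -/e.
rewrite !mulmx0 !scaler0 mul0mx add0r.
rewrite -!(mulmxA u P) -!(mulmxA u (P *m E)) PEd// PEd; last first.
  by rewrite mulmxA eb mul0mx.
have De : e *m double_last R m = 2 *: e := kervec_double_last R m.
have two0 : 2 != 0 :> R by rewrite pnatr_eq0.
have eNT : e *m N *m T = e *m N'.
  apply: (scalerI two0); rewrite !scalemxAl -!De -(mulmxA e _ N').
  by rewrite -PNT !mulmxA eP.
have PNTE : P *m N *m T = N' + e^T *m (e *m N') - P *m e^T *m (e *m N').
  have : double_last R m *m N' = N' + e^T *m (e *m N').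
    by rewrite mulmxDl mul1mx mulmxA.
  rewrite -PNT => <-; rewrite mulmxDl mul1mx mulmxDr mulmxDl !mulmxA.
  by rewrite -(mulmxA _ e N) -(mulmxA _ (e *m N) T) eNT !mulmxA addrK.
have PNiTm : P *m (N *m i) *m Tm = P *m N *m T *m i.
  by rewrite !mulmxA -(mulmxA _ i) iTm !mulmxA.
rewrite -!scalemxAl -(mulmxA u) PNiTm PNTE !(mulmxA u _ i) -scalerDr.
rewrite !scalemxAl -mulmxDl !scalemxAl; congr (_ *m i).
rewrite -!scalemxAl; congr (_ *: _).
rewrite /d /b !mulmxBr !mulmxDr !(mulmxA u) [u *m P *m e^T]mx11_scalar.
rewrite [u *m e^T]mx11_scalar -!(mulmxA _ e N') !mul_scalar_mx.
apply/rowP => j; rewrite !mxE !eqxx !mulr1n; ring.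
Qed.

(** Doubling the last row changes neither the rank nor the vanishing of that row,
    so both directions can be stated on [N] and [N'] themselves. *)
Lemma A2_equiv_rank (R : realType) m p (N N' : 'M[R]_(m + 1, 1 + p))
    (f g : 'rV[R]_(m + 1) -> 'rV[R]_(m + (1 + p))) :
  normal_jet N f -> normal_jet N' g ->
  A2_equiv f g <->
  \rank N = \rank N' /\ (kervec R m *m N == 0) = (kervec R m *m N' == 0).
Proof.
move=> jf jg; set D := double_last R m; set e := kervec R m.
have uD : D \in unitmx := double_last_unit R m.
have rD (M : 'M[R]_(m + 1, 1 + p)) : \rank (D *m M) = \rank M.
  by have := @mxrank_mul_unit _ _ _ _ _ M uD (unitmx1 _ _); rewrite mulmx1.
have two0 : 2 != 0 :> R by rewrite pnatr_eq0.
have eD (M : 'M[R]_(m + 1, 1 + p)) : (e *m (D *m M) == 0) = (e *m M == 0).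
  by rewrite mulmxA kervec_double_last -scalemxAl scaler_eq0 (negPf two0).
split=> [/(A2_equiv_normal_jet jf jg)[P [S [l [uP uS l0 eP DN]]]]|[rN eN]].
  rewrite -/D -/e in DN eP; have uPD : P *m D \in unitmx by rewrite unitmx_mul uP.
  split.
    rewrite -[RHS]rD DN mxrank_scale_nz//.
    exact: (esym (@mxrank_mul_unit _ _ _ _ _ N uPD uS)).
  rewrite -[RHS]eD DN -scalemxAr scaler_eq0 (negPf l0) /=.
  have -> : e *m (P *m D *m N *m S) = l *: (e *m (D *m N) *m S).
    by rewrite !mulmxA eP -!scalemxAl.
  rewrite scaler_eq0 (negPf l0) /= (mulmx_free_eq0 (e *m _)) ?row_free_unit//.
apply: (normal_jet_flag_equiv jf jg); apply: flag_equivP; first by rewrite !rD.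
by rewrite !eD.
Qed.

(** * Images of paraboloids: linear subspaces and half-lines *)

(** The image of the paraboloid [{(y, |y|^2)}] under the linear map given by
    the matrix [col_mx L A]. *)
Definition paraboloid (R : realType) n (L : 'M[R]_(2, n)) (A : 'rV[R]_n) :
  set 'rV[R]_n := [set y *m L + dot y y *: A | y in [set: 'rV[R]_2]].

Lemma dotE (R : realType) n (u v : 'rV[R]_n) : dot u v = (u *m v^T) 0 0.
Proof. by rewrite mxE; apply: eq_bigr => i _; rewrite mxE. Qed.

Lemma dot_ge0 (R : realType) n (u : 'rV[R]_n) : 0 <= dot u u.
Proof. by apply: sumr_ge0 => i _; rewrite -expr2 sqr_ge0. Qed.

Lemma dot_eq0 (R : realType) n (u : 'rV[R]_n) : (dot u u == 0) = (u == 0).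
Proof.
apply/idP/eqP => [|->]; last by rewrite /dot big1// => i _; rewrite mxE mul0r.
rewrite psumr_eq0 => [/allP u0|i _]; last by rewrite -expr2 sqr_ge0.
apply/rowP => i; have := u0 i (mem_index_enum i).
by rewrite mulf_eq0 orbb mxE => /eqP.
Qed.

Lemma dotDl (R : realType) n (u v w : 'rV[R]_n) : dot (u + v) w = dot u w + dot v w.
Proof. by rewrite !dotE mulmxDl mxE. Qed.

Lemma dotZl (R : realType) n a (u w : 'rV[R]_n) : dot (a *: u) w = a * dot u w.
Proof. by rewrite !dotE -scalemxAl mxE. Qed.

Lemma dotC (R : realType) n (u v : 'rV[R]_n) : dot u v = dot v u.
Proof. by apply: eq_bigr => i _; rewrite mulrC. Qed.

Lemma dotDr (R : realType) n (u v w : 'rV[R]_n) : dot w (u + v) = dot w u + dot w v.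
Proof. by rewrite dotC dotDl !(dotC w). Qed.

Lemma dotZr (R : realType) n a (u w : 'rV[R]_n) : dot w (a *: u) = a * dot w u.
Proof. by rewrite dotC dotZl !(dotC w). Qed.

Lemma ord2_enum (P : 'I_2 -> Prop) : P 0 -> P 1 -> forall i, P i.
Proof.
move=> P0 P1 [[|[|//]] i2]; [have -> : Ordinal i2 = 0 by apply: val_inj|
  have -> : Ordinal i2 = 1 by apply: val_inj]; by [].
Qed.

Lemma sum_ord2 (V : nmodType) (F : 'I_2 -> V) : \sum_i F i = F 0 + F 1.
Proof. by rewrite big_ord_recl big_ord1; congr (_ + F _); apply: val_inj. Qed.

(** The rotation that takes the direction of [a] to a coordinate axis of the
    plane. *)
Lemma orthonormal_frame (R : realType) (a : 'rV[R]_2) : a != 0 ->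
  exists u1 u2 : 'rV[R]_2,
    [/\ dot u1 u1 = 1, dot u2 u2 = 1, dot u1 u2 = 0,
        (exists k, u2 = k *: a) &
        forall y, y = dot y u1 *: u1 + dot y u2 *: u2].
Proof.
move=> a0; have a_gt0 : 0 < dot a a by rewrite lt_def dot_eq0 a0 dot_ge0.
pose k := (Num.sqrt (dot a a))^-1.
have k2 : k ^+ 2 * (a 0 0 ^+ 2 + a 0 1 ^+ 2) = 1.
  rewrite exprVn sqr_sqrtr ?ltW// [X in _^-1 * X](_ : _ = dot a a) ?mulVf ?gt_eqF//.
  by rewrite /dot sum_ord2 !expr2.
have a10 : (1 == 0 :> 'I_2) = false by [].
exists (\row_i (k * if i == 0 then a 0 1 else - a 0 0)), (k *: a).
clearbody k; split; last first.
- move=> y; apply/rowP; apply: ord2_enum; rewrite /dot !sum_ord2 !mxE !eqxx a10.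
    transitivity (y 0 0 * (k ^+ 2 * (a 0 0 ^+ 2 + a 0 1 ^+ 2))); first by rewrite k2 mulr1.
    ring.
  transitivity (y 0 1 * (k ^+ 2 * (a 0 0 ^+ 2 + a 0 1 ^+ 2))); first by rewrite k2 mulr1.
  ring.
- by exists k.
- by rewrite /dot !sum_ord2 !mxE !eqxx a10; ring.
- by rewrite /dot !sum_ord2 !mxE -k2; ring.
- by rewrite /dot !sum_ord2 !mxE !eqxx a10 -k2; ring.
Qed.

Lemma paraboloid0 (R : realType) n (L : 'M[R]_(2, n)) (A : 'rV[R]_n) :
  paraboloid L A 0.
Proof.
exists 0 => //; rewrite mul0mx add0r; apply/eqP.
by rewrite scaler_eq0 dot_eq0 eqxx.
Qed.

Lemma paraboloid_sub (R : realType) n (L : 'M[R]_(2, n)) (A x : 'rV[R]_n) :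
  paraboloid L A x -> (x <= col_mx L A)%MS.
Proof.
move=> [y _ <-]; rewrite -addsmxE; apply: addmx_sub.
  by apply: submx_trans (addsmxSl _ _); rewrite submxMl.
by apply: submx_trans (addsmxSr _ _); rewrite scalemx_sub.
Qed.

(** The values at [y] and [- y] recover [y *m L] and [|y|^2 A] separately. *)
Lemma paraboloid_span (R : realType) n k (L : 'M[R]_(2, n)) (A : 'rV[R]_n)
    (W : 'M[R]_(k, n)) :
  (forall x, paraboloid L A x -> (x <= W)%MS) -> (col_mx L A <= W)%MS.
Proof.
move=> sub.
have two0 : 2 != 0 :> R by rewrite pnatr_eq0.
have half (v : 'rV[R]_n) : ((v + v)%R <= W)%MS -> (v <= W)%MS.
  by move=> vW; rewrite -[v](scalerK two0) scalemx_sub// scaler_nat mulr2n.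
have even y : ((dot y y *: A) <= W)%MS /\ (y *m L <= W)%MS.
  have yp : ((y *m L + dot y y *: A)%R <= W)%MS by apply: sub; exists y.
  have yn : ((- (y *m L) + dot y y *: A)%R <= W)%MS.
    apply: sub; exists (- y) => //; rewrite mulNmx; congr (_ + _ *: _).
    by rewrite -scaleN1r dotZl dotZr mulrA mulrN1 opprK mul1r.
  split; apply: half.
    by have := addmx_sub yp yn; rewrite addrACA subrr add0r.
  have := addmx_sub yp (scalemx_sub (-1) yn).
  by rewrite scaleN1r opprD opprK addrACA subrr addr0.
rewrite -addsmxE addsmx_sub; apply/andP; split.
  by apply/row_subP => i; rewrite rowE; have [] := even (delta_mx 0 i).
have [+ _] := even (delta_mx 0 0); apply: submx_trans.
rewrite eqmx_scale// dotE trmx_delta mul_delta_mx mxE oner_eq0//.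
Qed.

Lemma flat_through0 (R : realType) n k (S : set 'rV[R]_n) : is_flat k S -> S 0 ->
  exists2 B : 'M[R]_(k, n), row_free B & S = [set x | (x <= B)%MS].
Proof.
move=> [q [B [fB ->]]] [t0 _ t0B]; exists B => //.
apply/seteqP; split => x /=.
  move=> [t _ <-]; have -> : q = - t0 *m B by apply/eqP; rewrite mulNmx -addr_eq0 t0B.
  by rewrite -mulmxDl submxMl.
move=> /submxP[t ->]; exists (t + t0) => //.
by rewrite mulmxDl addrCA t0B addr0.
Qed.

Lemma is_flat_row_space (R : realType) n k (B : 'M[R]_(k, n)) :
  row_free B -> is_flat k [set x | (x <= B)%MS].
Proof.
move=> fB; exists 0, B; split=> //; apply/seteqP; split => x /=.
  by move=> /submxP[t ->]; exists t => //; rewrite add0r.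
by move=> [t _ <-]; rewrite add0r submxMl.
Qed.

Lemma is_flat_submx (R : realType) n k (V : 'M[R]_(k, n)) :
  is_flat (\rank V) [set x | (x <= V)%MS].
Proof.
have := is_flat_row_space (row_base_free V); congr (is_flat _ _).
by apply/seteqP; split => x /=; rewrite eq_row_base.
Qed.

(** Going far enough from [0] in the direction [- A] leaves the image: the
    component along [A] of a point of the image is bounded below, as is seen
    by completing the square. *)
Lemma paraboloid_nonlinear (R : realType) n (L : 'M[R]_(2, n)) (A : 'rV[R]_n) :
  A != 0 -> exists2 x, (x <= A)%MS & ~ paraboloid L A x.
Proof.
move=> A0; have a0 : 0 < dot A A by rewrite lt_def dot_eq0 A0 dot_ge0.
pose b := (dot A A)^-1 *: (A *m L^T).
have bE y : dot (y *m L) A = dot A A * dot y b.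
  by rewrite dotZr mulrA mulfV ?mul1r ?gt_eqF// !dotE trmx_mul trmxK mulmxA.
clearbody b; exists (- (1 + dot b b / 4) *: A); first exact: scalemx_sub.
move=> [y _ /(congr1 (fun u => dot u A))]; rewrite dotDl !dotZl bE.
rewrite [RHS]mulrC [X in _ + X]mulrC -mulrDr => /(mulfI (lt0r_neq0 a0)) e.
have := dot_ge0 (y + 2^-1 *: b); rewrite dotDl !dotDr !dotZl !dotZr (dotC b y).
by move: (dot y b) (dot b b) (dot y y) e => p q r; lra.
Qed.

Lemma paraboloid_linear (R : realType) n (L : 'M[R]_(2, n)) :
  paraboloid L 0 = [set x | (x <= L)%MS].
Proof.
apply/seteqP; split => x /= [].
  by move=> y _ <-; rewrite scaler0 addr0 submxMl.
by move=> /submxP[y ->]; exists y => //; rewrite scaler0 addr0.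
Qed.

(** For every dimension at once, the image is flat only when it is linear. *)
Lemma is_flat_paraboloid (R : realType) n k (L : 'M[R]_(2, n)) (A : 'rV[R]_n) :
  is_flat k (paraboloid L A) <-> \rank (col_mx L A) = k /\ A = 0.
Proof.
split=> [/flat_through0/(_ (paraboloid0 _ _))[B fB E]|[<- ->]].
  have VB : (col_mx L A <= B)%MS by apply: paraboloid_span => x; rewrite E.
  split.
    rewrite -(eqP fB); apply/eqP; rewrite eqn_leq mxrankS//=; apply: mxrankS.
    apply/row_subP => i; apply: paraboloid_sub; rewrite E /=; exact: row_sub.
  apply/eqP/negPn/negP => /(paraboloid_nonlinear L)[x xA]; apply.
  rewrite E /=; apply: submx_trans VB; apply: submx_trans xA _.
  by rewrite -addsmxE addsmxSr.
rewrite rank_col_mx0; exists 0, (row_base L); split; first exact: row_base_free.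
rewrite paraboloid_linear; apply/seteqP; split => x /=.
  by rewrite -(eq_row_base L) => /submxP[t ->]; exists t => //; rewrite add0r.
by move=> [t _ <-]; rewrite add0r -(eq_row_base L) submxMl.
Qed.

Lemma is_point_flat (R : realType) n (S : set 'rV[R]_n) :
  is_point S <-> is_flat 0 S.
Proof.
have E (q : 'rV[R]_n) (B : 'M[R]_(0, n)) :
    [set q + t *m B | t in [set: 'rV[R]_0]] = [set q].
  rewrite [B]flatmx0; apply/seteqP; split=> x /= [].
    by move=> t _ <-; rewrite mulmx0 addr0.
  by exists 0 => //; rewrite mulmx0 addr0.
split=> [[q ->]|[q [B [_ ->]]]]; last by exists q; rewrite E.
by exists q, 0; rewrite E; split=> //; rewrite /row_free mxrank0.
Qed.

(** When [L] is a multiple of [A], the coefficient of [A] is a quadratic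
    polynomial in [y], whose values fill a half-line by completing the square.
    Conversely a half-line spans a line, and is not itself linear. *)
Lemma is_half_line_paraboloid (R : realType) n (L : 'M[R]_(2, n)) (A : 'rV[R]_n) :
  is_half_line (paraboloid L A) <-> \rank (col_mx L A) = 1%N /\ A != 0.
Proof.
split=> [[q [v [v0 E]]]|[rV A0]].
  have Gq t : 0 <= t -> paraboloid L A (q + t *: v) by rewrite E; exists t.
  have vV : (v <= col_mx L A)%MS.
    have -> : v = (q + 1 *: v) + -1 *: (q + 0 *: v).
      by rewrite scale0r addr0 scaleN1r scale1r addrAC subrr add0r.
    by apply: addmx_sub; [|apply: scalemx_sub]; apply: paraboloid_sub; apply: Gq.
  have qV : (q <= col_mx L A)%MS.
    by apply: paraboloid_sub; rewrite -[q]addr0 -(scale0r v); apply: Gq.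
  have [t0 t0_ge0 qE] : exists2 t0, 0 <= t0 & q + t0 *: v = 0.
    by have := paraboloid0 L A; rewrite E => -[t0]; exists t0.
  have qv : (q <= v)%MS.
    have -> : q = - t0 *: v by apply/eqP; rewrite scaleNr -addr_eq0 qE.
    exact: scalemx_sub.
  have Vv : (col_mx L A <= v)%MS.
    apply: paraboloid_span => x; rewrite E => -[t _ <-].
    by rewrite addmx_sub// scalemx_sub.
  split.
    have rv : \rank v = 1%N by rewrite rank_rV v0.
    by rewrite -[RHS]rv; apply/eqP; rewrite eqn_leq !mxrankS//.
  apply/negP => /eqP A0.
  have : paraboloid L A (q + (-1) *: v).
    move: qV vV; rewrite A0 paraboloid_linear -!addsmxE !addsmx0 => qL vL.
    by rewrite /= addmx_sub// scalemx_sub.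
  rewrite E => -[t /= t_ge0 /addrI/eqP]; rewrite -subr_eq0 -scalerBl scaler_eq0.
  by rewrite (negPf v0) orbF opprK gt_eqF// ltr_wpDl.
have AV : (A <= col_mx L A)%MS by rewrite -addsmxE addsmxSr.
have : (col_mx L A <= A)%MS by rewrite -(mxrank_leqif_sup AV).2 rV rank_rV A0.
rewrite -addsmxE addsmx_sub => /andP[/submxP[b LE] _].
have yE (y : 'rV[R]_2) : y *m L = dot y b^T *: A.
  by rewrite LE mulmxA [y *m b]mx11_scalar mul_scalar_mx dotE trmxK.
have [c bc] : exists c, b^T = 2 *: c.
  by exists (2^-1 *: b^T); rewrite scalerA mulfV ?pnatr_eq0// scale1r.
rewrite bc in yE.
exists (- dot c c *: A), A; split=> //; apply/seteqP; split => x /= [].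
  move=> y _ <-; exists (dot (y + c) (y + c)); first exact: dot_ge0.
  rewrite yE -!scalerDl; congr (_ *: _).
  by rewrite dotDl !dotDr (dotC c y) dotZr; ring.
move=> t t_ge0 <-; exists (Num.sqrt t *: delta_mx 0 0 + -1 *: c) => //.
rewrite yE -!scalerDl; congr (_ *: _).
have dd : dot (delta_mx 0 0) (delta_mx 0 0 : 'rV_2) = 1 :> R.
  by rewrite dotE trmx_delta mul_delta_mx mxE !eqxx.
rewrite !(dotDl, dotDr, dotZl, dotZr) (dotC c (delta_mx 0 0)) dd -[X in _ = _ + X](sqr_sqrtr t_ge0).
ring.
Qed.

(** * Images of paraboloids: planar regions *)

(** A linear relation between the rows of [col_mx L A] says that some unit
    vector [u2] of the parameter plane is sent by [L] to a multiple of [A].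
    In an orthonormal frame [u1, u2], completing the square in the second
    coordinate turns the image into the set above a parabola. *)
Lemma paraboloid_parabola (R : realType) n (L : 'M[R]_(2, n)) (A : 'rV[R]_n) :
  \rank (col_mx L A) = 2%N -> A != 0 ->
  exists (B : 'rV[R]_n) (c : R), row_free (col_mx B A) /\
    paraboloid L A =
    [set x | exists p w, p ^+ 2 - c ^+ 2 <= w /\ x = p *: B + w *: A].
Proof.
move=> rV A0.
have [w w0 wV] : exists2 w : 'rV[R]_(2 + 1), w != 0 & w *m col_mx L A = 0.
  have : kermx (col_mx L A) != 0 by rewrite kermx_eq0 /row_free rV.
  by move=> /rowV0Pn[w /sub_kermxP wV w0]; exists w.
move: w0 wV; rewrite -[w]hsubmxK mul_row_col; set a := lsubmx w; set b := rsubmx w.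
rewrite [b]mx11_scalar mul_scalar_mx => ab0 aLA.
have a0 : a != 0.
  apply: contra_neq ab0 => a0; move: aLA; rewrite a0 mul0mx add0r => /eqP.
  by rewrite scaler_eq0 (negPf A0) orbF => /eqP ->; rewrite raddf0 row_mx0.
have [u1 [u2 [u11 u22 u12 [k u2a] frame]]] := orthonormal_frame a0.
pose B := u1 *m L.
have [c u2L] : exists c, u2 *m L = (2 * c) *: A.
  exists (2^-1 * - (k * b 0 0)); rewrite mulrA mulfV ?pnatr_eq0// mul1r.
  rewrite u2a -scalemxAl scaleNr -scalerA -scalerN; congr (_ *: _).
  by apply/eqP; rewrite -addr_eq0 aLA.
have yL y : y *m L + dot y y *: A =
    dot y u1 *: B + (dot y u1 ^+ 2 + (dot y u2 + c) ^+ 2 - c ^+ 2) *: A.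
  rewrite {1 2 3}[y]frame mulmxDl -!scalemxAl -/B u2L -addrA scalerA -scalerDl.
  congr (_ + _ *: _); move: (dot y u1) (dot y u2) => p r.
  by rewrite !(dotDl, dotDr, dotZl, dotZr) (dotC u2 u1) u11 u22 u12; ring.
exists B, c; split.
  rewrite /row_free eqn_leq rank_leq_row -[X in (X <= _)%N]rV.
  apply/mxrankS/paraboloid_span => x [y _ <-]; rewrite yL -addsmxE.
  apply: addmx_sub; apply: scalemx_sub; [exact: addsmxSl|exact: addsmxSr].
apply/seteqP; split => x /= [].
  move=> y _ <-; rewrite yL; do 2 eexists; split; last by [].
  by rewrite lerD2r lerDl sqr_ge0.
move=> p [v [pv ->]]; pose r := Num.sqrt (v - p ^+ 2 + c ^+ 2) - c.
have r2 : (r + c) ^+ 2 = v - p ^+ 2 + c ^+ 2.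
  by rewrite subrK sqr_sqrtr//; move: pv; lra.
exists (p *: u1 + r *: u2) => //.
rewrite yL !dotDl !dotZl (dotC u2 u1) u11 u22 u12 !mulr0 !mulr1 addr0 add0r r2.
by congr (_ + _ *: _); ring.
Qed.

Lemma star_connected (R : realType) n (S : set 'rV[R]_n) (x0 : 'rV[R]_n) :
  S x0 ->
  (forall x t, S x -> 0 <= t <= 1 -> S (x0 + t *: (x - x0))) -> connected S.
Proof.
move=> Sx0 star.
have -> : S = \bigcup_(x in S) [set x0 + t *: (x - x0) | t in `[0, 1]].
  apply/seteqP; split => [x Sx|y [x Sx [t /= + <-]]].
    by exists x => //; exists 1; rewrite /= ?in_itv/= ?ler01 ?lexx// scale1r addrC subrK.
  by rewrite in_itv => /star; apply.
apply: bigcup_connected => [|x Sx].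
  exists x0 => x Sx; exists 0; rewrite /= ?in_itv/= ?ler01 ?lexx//.
  by rewrite scale0r addr0.
apply: connected_continuous_connected; first exact: segment_connected.
apply: continuous_subspaceT => t.
by apply: cvgD; [exact: cvg_cst|exact: scalel_continuous].
Qed.

Lemma closure_ray (R : realType) n (S : set 'rV[R]_n) (x v : 'rV[R]_n) :
  (forall t, 0 < t -> S (x + t *: v)) -> closure S x.
Proof.
move=> St B Bx.
have ct : {for 0, continuous (fun t : R => x + t *: v)}.
  by apply: cvgD; [exact: cvg_cst|exact: scalel_continuous].
have /nbhs_ballP[e /= e0 eB] : nbhs (0 : R) ((fun t : R => x + t *: v) @^-1` B).
  by apply: ct; rewrite scale0r addr0.
exists (x + (e / 2) *: v); split; first by apply: St; rewrite divr_gt0.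
apply: eB; rewrite -ball_normE /ball_/= sub0r normrN gtr0_norm ?divr_gt0//.
by rewrite ltr_pdivrMr// ltr_pMr// ltr1n.
Qed.

(** The open region is the part of the plane strictly above the parabola: it is
    star-shaped about [A], and the points of the parabola are limits of points
    above them. *)
Lemma parabola_region (R : realType) n (B A : 'rV[R]_n) (c : R) :
  row_free (col_mx B A) ->
  region_of [set x | (x <= col_mx B A)%MS]
    [set x | exists p w, p ^+ 2 - c ^+ 2 <= w /\ x = p *: B + w *: A].
Proof.
move=> /row_freeP[T TK].
pose h (x : 'rV[R]_n) : R := (x *m T) 0 1 - (x *m T) 0 0 ^+ 2 + c ^+ 2.
have coordE p w : (p *: B + w *: A) *m T = row_mx p%:M w%:M.
  have -> : p *: B + w *: A = row_mx p%:M w%:M *m col_mx B A.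
    by rewrite mul_row_col !mul_scalar_mx.
  by rewrite -mulmxA TK mulmx1.
have hE p w : h (p *: B + w *: A) = w - p ^+ 2 + c ^+ 2.
  rewrite /h coordE.
  have -> : 1 = rshift 1 (0 : 'I_1) :> 'I_(1 + 1) by apply: val_inj.
  have -> : 0 = lshift 1 (0 : 'I_1) :> 'I_(1 + 1) by apply: val_inj.
  by rewrite row_mxEr row_mxEl !mxE !eqxx.
pose O := [set x | 0 < h x].
have PO : [set x | (x <= col_mx B A)%MS] `&` O =
    [set x | exists p w, p ^+ 2 - c ^+ 2 < w /\ x = p *: B + w *: A].
  apply/seteqP; split => x /= [].
    move=> /submxP[y ->]; rewrite -[y]hsubmxK mul_row_col.
    rewrite [lsubmx y]mx11_scalar [rsubmx y]mx11_scalar !mul_scalar_mx /O /= hE.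
    move: (lsubmx y 0 0) (rsubmx y 0 0) => p w h0.
    by exists p, w; split=> //; move: h0; lra.
  move=> p [w [pw ->]]; split; last by rewrite /O /= hE; move: pw; lra.
  by rewrite -addsmxE addmx_sub// scalemx_sub// ?addsmxSl ?addsmxSr.
have base : [set x | exists p w, p ^+ 2 - c ^+ 2 < w /\ x = p *: B + w *: A] A.
  exists 0, 1; rewrite scale0r add0r scale1r; split=> //.
  by have := sqr_ge0 c; lra.
exists O; rewrite PO; split.
- have d1 i x : differentiable (fun x : 'rV[R]_n => (x *m T) 0 i : R) x.
    by apply: differentiable_entry; exact: mulmxr_differentiable.
  have hc x : {for x, continuous h}.
    rewrite (_ : h = (fun x => (x *m T) 0 1 : R) - (fun x => (x *m T) 0 0 : R) ^+ 2
                     + cst (c ^+ 2)); last by apply/funext.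
    apply: differentiable_continuous; apply: differentiableD => //.
    by apply: differentiableB => //; apply: differentiableX.
  by apply: (@open_comp _ _ h [set t | 0 < t]) => [x _|]; [exact: hc|exact: open_gt].
- by exists A.
- apply: star_connected base _ => x t [p [w [pw ->]]] /andP[t0 t1].
  exists (t * p), (1 - t + t * w); split; last first.
    rewrite scalerBr !scalerDr !scalerA scalerDl scalerBl scale1r.
    by rewrite addrCA [A + _]addrC -!addrA; congr (_ + _); rewrite addrC addrA.
  have := sqr_ge0 c; have := sqr_ge0 p; move: pw.
  move: (c ^+ 2) (p ^+ 2) (exprMn 2 t p) => C P -> pw P0 C0.
  have t2 : t ^+ 2 * P <= t * P by rewrite ler_wpM2r// expr2 ler_piMr.
  case: (ltgtP t 0) t0 => // [t_gt0|->] _; last by rewrite expr2; lra.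
  have tw : t * (P - C) < t * w by rewrite ltr_pM2l.
  have tC : t * C <= C by rewrite ler_piMl.
  by move: tw t2 tC; rewrite mulrBr; lra.
- by move=> x [p [w [pw ->]]]; exists p, w; rewrite ltW.
move=> x [p [w [pw ->]]]; apply: (@closure_ray _ _ _ _ A) => t t0.
exists p, (w + t); split; last by rewrite -addrA -scalerDl.
by rewrite ltr_pwDr.
Qed.

(** A planar region spans a plane; when [A = 0] the image would be this whole
    plane, which the definition of a planar region excludes. *)
Lemma is_planar_region_paraboloid (R : realType) n (L : 'M[R]_(2, n)) (A : 'rV[R]_n) :
  is_planar_region (paraboloid L A) <-> \rank (col_mx L A) = 2%N /\ A != 0.
Proof.
split=> [[P [planeP subP _ notline notP]]|[rV A0]].
  have [B fB PE] := flat_through0 planeP (subP _ (paraboloid0 L A)).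
  have VB : (col_mx L A <= B)%MS.
    by apply: paraboloid_span => x /subP; rewrite PE.
  have B0 : row 0 B != 0.
    rewrite rowE mulmx_free_eq0//; apply/rV0Pn; exists 0.
    by rewrite mxE !eqxx oner_eq0.
  have rV : \rank (col_mx L A) = 2%N.
    apply/eqP; rewrite eqn_leq; apply/andP; split.
      by rewrite -[X in (_ <= X)%N](eqP fB) mxrankS.
    rewrite ltnNge; apply/negP => rV1; apply: notline.
    have [V0|V0] := eqVneq (\rank (col_mx L A)) 0%N.
      exists [set x | (x <= row 0 B)%MS].
        by apply: is_flat_row_space; rewrite /row_free rank_rV B0.
      move=> x /paraboloid_sub; move/eqP: V0; rewrite mxrank_eq0 => /eqP ->.
      by move=> /submx_trans; apply; apply: sub0mx.
    have r1 : \rank (col_mx L A) = 1%N by apply/eqP; rewrite eqn_leq rV1 lt0n.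
    exists [set x | (x <= col_mx L A)%MS]; last exact: paraboloid_sub.
    by have := is_flat_submx (col_mx L A); rewrite r1.
  split=> //; apply/eqP => A0; apply: notP; rewrite PE.
  have VBE : (col_mx L A :=: B)%MS.
    by apply/eqmxP; rewrite -(mxrank_leqif_eq VB).2 rV (eqP fB).
  apply/seteqP; split=> x /=; first by move/paraboloid_sub; rewrite VBE.
  by rewrite -VBE A0 paraboloid_linear -addsmxE addsmx0.
have [B [c [fB E]]] := paraboloid_parabola rV A0.
have VB : (col_mx L A <= col_mx B A)%MS.
  apply: paraboloid_span => x; rewrite E => -[p [w [_ ->]]].
  by rewrite -addsmxE addmx_sub// scalemx_sub// ?addsmxSl ?addsmxSr.
exists [set x | (x <= col_mx B A)%MS]; split.
- exact: is_flat_row_space.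
- by move=> x /paraboloid_sub /submx_trans; apply.
- by rewrite E; exact: parabola_region.
- move=> [S lineS subS].
  have [D fD SE] := flat_through0 lineS (subS _ (paraboloid0 L A)).
  have /mxrankS : (col_mx L A <= D)%MS.
    by apply: paraboloid_span => x /subS; rewrite SE.
  by rewrite rV (eqP fD).
have [x xA nx] := paraboloid_nonlinear L A0; move=> PE; apply: nx; rewrite PE /=.
by apply: submx_trans xA _; rewrite -addsmxE addsmxSr.
Qed.

(** * Images of paraboloids: surfaces *)

(** Membership in a subspace is the vanishing of a linear map, which can be
    differentiated. *)
Lemma derive_in_subspace (R : realType) n m k (V : 'M[R]_(k, m))
    (U : set 'rV[R]_n) (h : 'rV[R]_n -> 'rV[R]_m) (x : 'rV[R]_n) :
  open U -> U x -> (forall y, U y -> (h y <= V)%MS) -> differentiable h x ->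
  ('J h x <= V)%MS.
Proof.
move=> oU Ux hV dh; rewrite submxE.
have dg := mulmxr_differentiable (cokermx V) (h x).
have Jg : 'J (fun z : 'rV[R]_m => z *m cokermx V) (h x) = cokermx V.
  apply/row_matrixP => i; apply: etrans (row_jacobian i dg) _.
  have E : (fun z : 'rV[R]_m => z *m cokermx V) =
           quadmap 0 (cokermx V) (fun i j => 0).
    by apply/funext => z; rewrite quadmapE add0r big1 ?addr0// => a _;
      rewrite big1// => b _; rewrite scaler0.
  rewrite E partial_quadmap big1 ?addr0// => a _.
  exact: scaler0.
have <- : 'J ((fun z : 'rV[R]_m => z *m cokermx V) \o h) x = 'J h x *m cokermx V.
  by apply: (etrans (jacobian_comp dh dg)); rewrite Jg.
apply/eqP; transitivity ('J (cst 0 : 'rV[R]_n -> 'rV[R]_(m)) x).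
  apply: eq_near_jacobian => //; first exact: differentiable_comp.
  near=> y; rewrite /=; apply/eqP; rewrite -submxE; apply: hV.
  by near: y; exact: open_nbhs_nbhs.
apply/row_matrixP => i; apply: etrans (row_jacobian i _) _ => //.
by rewrite /partial derive_cst row0.
Unshelve. all: by end_near. Qed.

(** A parametrised surface inside a subspace of dimension two has the latter as
    tangent space, and its second derivatives stay in it; so the normal sees no
    second derivative. *)
Lemma planar_curvature0 (R : realType) n k (V : 'M[R]_(k, n)) (W : 'M[R]_n)
    (S : set 'rV[R]_n) (q : 'rV[R]_n) (K : R) :
  (\rank V <= 2)%N -> (forall x, S x -> (x <= V)%MS) ->
  gaussian_curvature W S q K -> K = 0.
Proof.
move=> rV SV [U [V0 [phi [x [nu [[oU _ [sphi phiU] rphi _] [Ux _] _ nuJ ->]]]]]].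
have phiV y : U y -> (phi y <= V)%MS.
  by move=> Uy; apply: SV; have [] : (S `&` V0) (phi y) by rewrite -phiU; exists y.
have dphi y : U y -> differentiable phi y by move=> Uy; apply: (sphi 1).1.
have ddphi j y : U y -> differentiable (partial j phi) y.
  by move=> Uy; apply: ((sphi 2).2 (delta_mx 0 j)).1.
have JV y : U y -> ('J phi y <= V)%MS.
  by move=> Uy; apply: (derive_in_subspace oU Uy phiV (dphi _ Uy)).
have pV j y : U y -> (partial j phi y <= V)%MS.
  by move=> Uy; rewrite -(row_jacobian j (dphi _ Uy)); exact: submx_trans (row_sub j _) (JV _ Uy).
have ppV i j : (partial i (partial j phi) x <= V)%MS.
  rewrite -(row_jacobian i (ddphi j _ Ux)); apply: (submx_trans (row_sub i _)).
  exact: (derive_in_subspace oU Ux (pV j) (ddphi j _ Ux)).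
have VJ : (V <= 'J phi x)%MS.
  rewrite -(mxrank_leqif_sup (JV _ Ux)).2 eqn_leq mxrankS ?JV//=.
  by rewrite rphi.
have h0 i j : dot nu (partial i (partial j phi) x) = 0.
  have /submxP[t ->] := submx_trans (ppV i j) VJ.
  rewrite dotE trmx_mul mulmxA.
  have -> : nu *m ('J phi x)^T = 0.
    apply/rowP => a; rewrite [RHS]mxE -[RHS](nuJ a).
    rewrite -(row_jacobian a (dphi _ Ux)) mxE; apply: eq_bigr => b _.
    by rewrite !mxE.
  by rewrite mul0mx mxE.
have flat (a b c d : R) : a = 0 -> b = 0 -> c = 0 -> (a * b - c ^+ 2) / d = 0.
  by move=> -> -> ->; rewrite mul0r expr0n subrr mul0r.
exact: (flat _ _ _ _ (h0 0 0) (h0 1 1) (h0 0 1)).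
Qed.

Lemma substantial_rank (R : realType) n (W : 'M[R]_n) (L : 'M[R]_(2, n)) (A : 'rV[R]_n) :
  substantial_surface W (paraboloid L A) -> \rank (col_mx L A) = 3%N.
Proof.
move=> [_ _ [q [K [_ gK /eqP K0]]]]; apply/eqP; rewrite eqn_leq.
rewrite (rank_leq_row (col_mx L A)) /= ltnNge; apply/negP => r2; apply: K0.
by apply: planar_curvature0 r2 _ gK => x; exact: paraboloid_sub.
Qed.

Definition paraboloid_map (R : realType) n (L : 'M[R]_(2, n)) (A : 'rV[R]_n) :=
  quadmap 0 L (fun i j => (i == j)%:R *: A).

Lemma paraboloid_mapE (R : realType) n (L : 'M[R]_(2, n)) (A : 'rV[R]_n) y :
  paraboloid_map L A y = y *m L + dot y y *: A.
Proof.
rewrite /paraboloid_map quadmapE add0r; congr (_ + _); rewrite /dot scaler_suml.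
apply: eq_bigr => i _; rewrite (bigD1 i)//= eqxx scale1r big1 ?addr0// => j ji.
by rewrite eq_sym (negPf ji) scale0r scaler0.
Qed.

Lemma partial_paraboloid_map (R : realType) n (L : 'M[R]_(2, n)) (A : 'rV[R]_n) i y :
  partial i (paraboloid_map L A) y = row i L + (2 * y 0 i) *: A.
Proof.
rewrite /paraboloid_map partial_quadmap; congr (_ + _).
rewrite (bigD1 i)//= big1 => [|j ji]; last first.
  by rewrite eq_sym (negPf ji) scale0r addr0 scaler0.
by rewrite eqxx scale1r addr0 -mulr2n -scaler_nat scalerA mulrC.
Qed.

(** When [col_mx L A] has independent rows, a right inverse of it composed with
    the projection [(y, |y|^2) |-> y] is a global continuous inverse. *)
Lemma paraboloid_local_parametrisation (R : realType) n (L : 'M[R]_(2, n)) (A : 'rV[R]_n) :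
  row_free (col_mx L A) ->
  local_parametrisation (paraboloid L A) setT setT (paraboloid_map L A).
Proof.
move=> fV; split; [exact: openT|exact: openT| | |].
- split; first exact: smooth_quadmap.
  rewrite setIT; apply/seteqP; split => x [y _ <-]; exists y => //.
    by rewrite paraboloid_mapE.
  by rewrite paraboloid_mapE.
- move=> x _; apply/eqP; rewrite -[_ == _]/(row_free ('J (paraboloid_map L A) x)).
  have -> : 'J (paraboloid_map L A) x = row_mx 1%:M (2 *: x^T) *m col_mx L A.
    apply/row_matrixP => i.
    apply: etrans (row_jacobian i (differentiable_quadmap _ _ _ _)) _.
    apply: etrans (partial_paraboloid_map L A i x) _.
    rewrite mul_row_col mul1mx linearD /=; congr (_ + _).
    by rewrite -scalemxAl linearZ /= row_mul [row i x^T]mx11_scalar mul_scalar_mx !mxE scalerA.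
  rewrite /row_free mxrankMfree// -/(row_free _).
  apply/row_freeP; exists (col_mx 1%:M 0).
  by rewrite mul_row_col mul1mx mulmx0 addr0.
have [T TK] := row_freeP fV.
exists (fun q => q *m (T *m col_mx 1%:M 0)); split.
  apply: continuous_subspaceT => q.
  exact/differentiable_continuous/mulmxr_differentiable.
move=> x _; rewrite paraboloid_mapE.
have -> : x *m L + dot x x *: A = row_mx x (dot x x)%:M *m col_mx L A.
  by rewrite mul_row_col mul_scalar_mx.
by rewrite mulmxA -(mulmxA _ _ T) TK mulmx1 mul_row_col mulmx1 mulmx0 addr0.
Qed.

Lemma row_free_neq0 (F : fieldType) m n (B : 'M[F]_(m, n)) i :
  row_free B -> row i B != 0.
Proof.
move=> fB; rewrite rowE mulmx_free_eq0//; apply/rV0Pn; exists i.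
by rewrite mxE !eqxx oner_eq0.
Qed.

(** The Gram determinant times [|B|^2] is the squared norm of
    [|B|^2 C - <B, C> B], a nontrivial combination of independent vectors. *)
Lemma gram_neq0 (R : realType) n (L : 'M[R]_(2, n)) : row_free L ->
  dot (row 0 L) (row 0 L) * dot (row 1 L) (row 1 L)
  - dot (row 0 L) (row 1 L) ^+ 2 != 0.
Proof.
move=> fL; set B := row 0 L; set C := row 1 L; apply/eqP => G0.
pose t : 'rV[R]_2 := \row_i if i == 0 then - dot B C else dot B B.
have tL : t *m L = - dot B C *: B + dot B B *: C.
  by rewrite mulmx_sum_row sum_ord2 !mxE.
have /eqP : dot (t *m L) (t *m L) = 0.
  have -> : dot (t *m L) (t *m L) =
    dot B B * (dot B B * dot C C - dot B C ^+ 2).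
    by rewrite tL !(dotDl, dotDr, dotZl, dotZr) (dotC C B); ring.
  by rewrite G0 mulr0.
rewrite dot_eq0 mulmx_free_eq0// => /eqP/rowP/(_ 1)/eqP; rewrite !mxE /= dot_eq0.
by rewrite (negPf (row_free_neq0 0 fL)).
Qed.

(** In a space of dimension three, two linear conditions leave a nonzero vector. *)
Lemma unit_normal (R : realType) n (W : 'M[R]_n) (L : 'M[R]_(2, n)) :
  \rank W = 3%N -> exists nu : 'rV[R]_n,
    [/\ (nu <= W)%MS, dot nu nu = 1 & forall i, dot nu (row i L) = 0].
Proof.
move=> rW.
have : (W :&: kermx L^T)%MS != 0.
  rewrite -mxrank_eq0 -lt0n -(ltn_add2l (\rank (W + kermx L^T)%MS)) addn0.
  rewrite mxrank_sum_cap rW mxrank_ker mxrank_tr.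
  apply: leq_ltn_trans (rank_leq_col _) _.
  by have := rank_leq_row L; have := rank_leq_col L; lia.
move=> /rowV0Pn[v]; rewrite sub_capmx => /andP[vW /sub_kermxP vL] v0.
have v_gt0 : 0 < dot v v by rewrite lt_def dot_eq0 v0 dot_ge0.
exists ((Num.sqrt (dot v v))^-1 *: v); split; first exact: scalemx_sub.
  rewrite dotZl dotZr mulrA -invfM -expr2 sqr_sqrtr ?ltW// mulVf//.
  exact: lt0r_neq0.
by move=> i; rewrite dotZl [dot v (row i L)]dotE rowE trmx_mul mulmxA vL mul0mx mxE mulr0.
Qed.

(** At the vertex the second derivatives are [2 A] times the identity, so the
    curvature is [4 <nu, A>^2] over a Gram determinant; [nu] is orthogonal to
    the rows of [L], hence it cannot be orthogonal to [A] as well. *)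
Lemma paraboloid_substantial (R : realType) n (W : 'M[R]_n) (L : 'M[R]_(2, n)) (A : 'rV[R]_n) :
  row_free (col_mx L A) -> (col_mx L A <= W)%MS -> \rank W = 3%N ->
  substantial_surface W (paraboloid L A).
Proof.
move=> fV VW rW.
have param := paraboloid_local_parametrisation fV.
split; first by move=> q /paraboloid_sub /submx_trans; apply.
  by move=> q Gq; exists setT, setT, (paraboloid_map L A).
have [nu [nuW nu1 nuL]] := unit_normal L rW.
have WV : (W <= col_mx L A)%MS.
  by rewrite -(mxrank_leqif_sup VW).2 rW (eqP fV).
have fL : row_free L.
  have [T TK] := row_freeP fV; apply/row_freeP; exists (T *m col_mx 1%:M 0).
  have -> : L = row_mx 1%:M 0 *m col_mx L A by rewrite mul_row_col mul1mx mul0mx addr0.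
  by rewrite mulmxA -(mulmxA _ _ T) TK mulmx1 mul_row_col mulmx1 mulmx0 addr0.
have nuA : dot nu A != 0.
  apply/eqP => nuA; have /submxP[t tE] := submx_trans nuW WV.
  have : dot nu nu = 0.
    rewrite {2}tE -[t]hsubmxK mul_row_col dotDr.
    rewrite [rsubmx t]mx11_scalar mul_scalar_mx dotZr nuA mulr0 addr0.
    by rewrite mulmx_sum_row sum_ord2 dotDr !dotZr !nuL !mulr0 addr0.
  by move/eqP; rewrite nu1 oner_eq0.
have P1 i : partial i (paraboloid_map L A) 0 = row i L.
  by rewrite partial_paraboloid_map mxE mulr0 scale0r addr0.
have P2 i j : partial i (partial j (paraboloid_map L A)) 0 = (2 * (i == j)%:R) *: A.
  rewrite /paraboloid_map partial2_quadmap (eq_sym j) -mulr2n -scaler_nat scalerA//.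
exists 0, (curvature_formula (paraboloid_map L A) nu 0); split.
- exact: paraboloid0.
- exists setT, setT, (paraboloid_map L A), 0, nu; split=> //.
    by split=> //; rewrite /paraboloid_map quadmap0.
  by move=> i; rewrite P1.
have K0 (p : 'I_2 -> 'rV[R]_n) (h : 'I_2 -> 'I_2 -> 'rV[R]_n) :
    (forall i, p i = row i L) -> (forall i j, h i j = (2 * (i == j)%:R) *: A) ->
    (dot nu (h 0 0) * dot nu (h 1 1) - dot nu (h 0 1) ^+ 2)
    / (dot (p 0) (p 0) * dot (p 1) (p 1) - dot (p 0) (p 1) ^+ 2) != 0.
  move=> pE hE; rewrite !hE !pE !dotZr !eqxx.
  have -> : (0 == 1 :> 'I_2) = false by [].
  rewrite !mulr1 mulr0 mul0r expr0n subr0 mulf_neq0 ?mulf_neq0 ?pnatr_eq0//.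
  by rewrite invr_eq0 gram_neq0.
exact: (K0 (fun i => partial i (paraboloid_map L A) 0)
           (fun i j => partial i (partial j (paraboloid_map L A)) 0) P1 P2).
Qed.

(** * The curvature locus and the classification *)

Lemma second_form_hess (R : realType) n m (f : 'rV[R]_n -> 'rV[R]_m) u :
  second_form f u u = normal_part f (hess f 0 u).
Proof.
rewrite /second_form /normal_part /hess mulmx_suml; apply: eq_bigr => i _.
by rewrite mulmx_suml; apply: eq_bigr => j _; rewrite -scalemxAl.
Qed.

(** Orthogonality of the two subspaces, by positivity of the scalar product. *)
Lemma tangent_normal_cap0 (R : realType) n m (J : 'M[R]_(n, m)) :
  (kermx J^T :&: <<J>>)%MS = 0.
Proof.
apply/eqP/rowV0P => v; rewrite sub_capmx genmxE => /andP[/sub_kermxP vJ /submxP[t vE]].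
by apply/eqP; rewrite -dot_eq0 dotE {2}vE trmx_mul mulmxA vJ mul0mx mxE.
Qed.

Lemma normal_part_id (R : realType) n m (f : 'rV[R]_n -> 'rV[R]_m) w :
  (w <= normal_subspace f)%MS -> normal_part f w = w.
Proof. by apply: proj_mx_id; exact: tangent_normal_cap0. Qed.

Lemma normal_mx_normal (R : realType) m p (N : 'M[R]_(m + 1, p))
    (f : 'rV[R]_(m + 1) -> 'rV[R]_(m + p)) :
  normal_jet N f -> (normal_mx R m p <= normal_subspace f)%MS.
Proof.
move=> [_ _ Jf _]; rewrite /normal_subspace Jf; apply/sub_kermxP.
exact: normal_mx_tangent_mx.
Qed.

Lemma rank_normal_subspace (R : realType) m p (N : 'M[R]_(m + 1, p))
    (f : 'rV[R]_(m + 1) -> 'rV[R]_(m + p)) :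
  normal_jet N f -> \rank (normal_subspace f) = p.
Proof.
move=> [_ _ Jf _]; rewrite /normal_subspace Jf mxrank_ker mxrank_tr.
have -> : \rank (tangent_mx R m p) = m by rewrite rank_diag_block_mx mxrank1 mxrank0 addn0.
by rewrite addKn.
Qed.

(** A unit vector [v] of the tangent plane together with the last coordinate [z]
    are the polar coordinates of [z v], which ranges over the whole plane. *)
Lemma curvature_locus_paraboloid (R : realType) p (N : 'M[R]_(2 + 1, p))
    (f : 'rV[R]_(2 + 1) -> 'rV[R]_(2 + p)) :
  normal_jet N f ->
  curvature_locus f = paraboloid (2 *: (usubmx N *m normal_mx R 2 p))
                                 (2 *: (dsubmx N *m normal_mx R 2 p)).
Proof.
move=> jf; have [_ _ Jf Hf] := jf.
have first u : first_form f u u = dot (lsubmx u) (lsubmx u).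
  rewrite /first_form -(mul_rV_lin1 ('d f 0)) -/(jacobian f 0) Jf mul_tangent_mx.
  by rewrite !dotE tr_row_mx mul_row_col mul0mx addr0.
have second v z : second_form f (row_mx v z%:M) (row_mx v z%:M) =
    (z *: v) *m (2 *: (usubmx N *m normal_mx R 2 p)) +
    (z ^+ 2) *: (2 *: (dsubmx N *m normal_mx R 2 p)).
  rewrite second_form_hess normal_part_id; last first.
    rewrite Hf; do 2 apply: scalemx_sub; rewrite mulmxA.
    by apply: submx_trans (normal_mx_normal jf); rewrite submxMl.
  rewrite Hf; have -> : (row_mx v z%:M *m (kervec R 2)^T) 0 0 = z.
    by rewrite tr_row_mx mul_row_col trmx0 trmx1 mulmx0 mulmx1 add0r mxE eqxx mulr1n.
  rewrite -{1}[N]vsubmxK mulmxA mul_row_col mul_scalar_mx mulmxDl !scalerDr.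
  rewrite -(mulmxA v) -scalemxAr -!scalemxAl !scalerA.
  by congr (_ *: _ + _ *: _); ring.
apply/seteqP; split => x [].
  move=> u; rewrite /= first -[u]hsubmxK row_mxKl [rsubmx u]mx11_scalar => u1 <-.
  rewrite second; exists (rsubmx u 0 0 *: lsubmx u) => //.
  by rewrite dotZl dotZr u1 mulr1 -expr2.
move=> y _ <-; have [->|y0] := eqVneq y 0.
  exists (row_mx (delta_mx 0 0) 0%:M).
    by rewrite /= first row_mxKl dotE trmx_delta mul_delta_mx mxE !eqxx.
  by rewrite second scale0r expr0n dotE !mul0mx [(0 : matrix _ _ _) 0 0]mxE.
have y_gt0 : 0 < dot y y by rewrite lt_def dot_eq0 y0 dot_ge0.
have r0 : Num.sqrt (dot y y) != 0 by rewrite gt_eqF// sqrtr_gt0.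
exists (row_mx ((Num.sqrt (dot y y))^-1 *: y) (Num.sqrt (dot y y))%:M).
  rewrite /= first row_mxKl dotZl dotZr mulrA -invfM -expr2 sqr_sqrtr ?ltW//.
  by rewrite mulVf// gt_eqF.
by rewrite second [_ *: (_ *: y)]scalerA mulfV// scale1r sqr_sqrtr// ltW.
Qed.

Lemma sum_ord3 (V : nmodType) (F : 'I_3 -> V) : \sum_i F i = F 0 + F 1 + F 2.
Proof.
rewrite !big_ord_recl big_ord0 addr0 addrA.
by congr (_ + F _ + F _); apply: val_inj.
Qed.

Lemma ord3_enum (P : 'I_3 -> Prop) : P 0 -> P 1 -> P 2 -> forall i, P i.
Proof.
move=> P0 P1 P2 [[|[|[|//]]] i3]; [have -> : Ordinal i3 = 0 by apply: val_inj|
  have -> : Ordinal i3 = 1 by apply: val_inj|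
  have -> : Ordinal i3 = 2 by apply: val_inj]; by [].
Qed.

Lemma kervec_delta (R : pzRingType) : kervec R 2 = delta_mx 0 2.
Proof.
have -> : 2 = rshift 2 (0 : 'I_1) :> 'I_3 by apply: val_inj.
apply: etrans (esym (@delta_mx_rshift R 1 2 1 0 0)); congr row_mx.
by apply/rowP => i; rewrite !ord1 !mxE eqxx.
Qed.

(** The coefficients of [xz], [yz] and [z^2], in this order, in the normal
    components. *)
Definition coef_mx (R : pzRingType) (b c a : seq R) : 'M[R]_(2 + 1, 1 + 2) :=
  \matrix_(i, j) (nth [::] [:: b; c; a] i)`_j.

Lemma map35_linquad (R : realType) F (a0 a1 a2 b0 b1 b2 c0 c1 c2 : R) :
  (forall x y z, F x y z =
     [:: x; y; z * (x * b0 + y * c0 + z * a0); z * (x * b1 + y * c1 + z * a1);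
         z * (x * b2 + y * c2 + z * a2)]) ->
  map35 F = linquad (tangent_mx R 2 3) (kervec R 2)^T
    (coef_mx [:: b0; b1; b2] [:: c0; c1; c2] [:: a0; a1; a2] *m normal_mx R 2 3).
Proof.
move=> FE; apply/funext => u; rewrite /linquad mul_tangent_mx mulmxA.
have -> : (u *m (kervec R 2)^T) 0 0 = u 0 2.
  by rewrite kervec_delta trmx_delta -colE mxE.
rewrite mul_mx_row mulmx0 mulmx1 scale_row_mx add_row_mx scaler0 addr0 add0r.
apply/rowP => j; rewrite mxE FE; case: (@split_ordP 2 3 j) => k ->.
  rewrite [RHS](@row_mxEl _ 1 2 3) mxE; case: k => -[|[|//]] k2 /=; congr (u 0 _); exact: val_inj.
rewrite [RHS](@row_mxEr _ 1 2 3) mxE; move: k; apply: ord3_enum;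
  by rewrite mxE (@sum_ord3 R) !mxE.
Qed.

Lemma coef_mx_kervec (R : pzRingType) (b c : seq R) (a0 a1 a2 : R) :
  (kervec R 2 *m coef_mx b c [:: a0; a1; a2] == 0) = [&& a0 == 0, a1 == 0 & a2 == 0].
Proof.
rewrite kervec_delta -rowE; apply/eqP/and3P => [/rowP a|[/eqP a00 /eqP a10 /eqP a20]].
  by split; apply/eqP; [have := a 0|have := a 1|have := a 2]; rewrite !mxE.
by apply/rowP; apply: ord3_enum; rewrite !mxE /=.
Qed.

(** The shape of the curvature locus is read off from the two invariants of the
    2-jet. *)
Lemma shape_ranks (R : realType) p (N : 'M[R]_(2 + 1, p))
    (f : 'rV[R]_(2 + 1) -> 'rV[R]_(2 + p)) (S := curvature_locus f) (N0 := kervec R 2 *m N == 0) :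
  normal_jet N f ->
  [/\ p = 3%N -> substantial_surface (normal_subspace f) S <-> \rank N = 3%N /\ N0 = false,
      is_planar_region S <-> \rank N = 2%N /\ N0 = false,
      is_half_line S <-> \rank N = 1%N /\ N0 = false &
      forall k, is_flat k S <-> \rank N = k /\ N0 = true].
Proof.
move=> jf; rewrite /S (curvature_locus_paraboloid jf).
set L := 2 *: (usubmx N *m _); set A := 2 *: (dsubmx N *m _).
have two0 : 2 != 0 :> R by rewrite pnatr_eq0.
have free : row_free (normal_mx R 2 p) by apply/row_freeP; exists (normal_mx R 2 p)^T; exact: normal_mx_tr.
have VE : col_mx L A = 2 *: (N *m normal_mx R 2 p).
  by rewrite -[N in RHS]vsubmxK mul_col_mx scale_col_mx.
have rV : \rank (col_mx L A) = \rank N.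
  by rewrite VE mxrank_scale_nz// mxrankMfree.
have AN : (A == 0) = N0.
  rewrite /A scaler_eq0 (negPf two0) mulmx_free_eq0// /N0.
  by rewrite -[N in RHS]vsubmxK mul_row_col mul0mx mul1mx add0r.
have AF : A != 0 <-> N0 = false by rewrite -AN; split => [/negPf|->].
have AT : A = 0 <-> N0 = true by rewrite -AN; split => [->|/eqP//]; rewrite eqxx.
split.
- move=> p3; split=> [/substantial_rank rV3|[rN _]].
    have rN : \rank N = 3%N by rewrite -rV.
    split=> //; rewrite /N0 mulmx_free_eq0; last by rewrite /row_free rN.
    by apply/negbTE/rV0Pn; exists 2; rewrite kervec_delta mxE !eqxx oner_eq0.
  apply: paraboloid_substantial.
  + by rewrite /row_free rV rN.
  + rewrite VE; apply: scalemx_sub; apply: submx_trans (normal_mx_normal jf).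
    by rewrite submxMl.
  + by rewrite (rank_normal_subspace jf).
- by rewrite is_planar_region_paraboloid rV AF.
- by rewrite is_half_line_paraboloid rV AF.
- by move=> k; rewrite is_flat_paraboloid rV AT.
Qed.

Lemma A2_equiv_map35 (R : realType) (N : 'M[R]_(2 + 1, 1 + 2))
    (f : 'rV[R]_(2 + 1) -> 'rV[R]_(2 + 3)) F (a0 a1 a2 b0 b1 b2 c0 c1 c2 : R) :
  normal_jet N f ->
  (forall x y z, F x y z =
     [:: x; y; z * (x * b0 + y * c0 + z * a0); z * (x * b1 + y * c1 + z * a1);
         z * (x * b2 + y * c2 + z * a2)]) ->
  A2_equiv f (map35 F) <->
  \rank N = \rank (coef_mx [:: b0; b1; b2] [:: c0; c1; c2] [:: a0; a1; a2]) /\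
  (kervec R 2 *m N == 0) = [&& a0 == 0, a1 == 0 & a2 == 0].
Proof.
move=> jf FE; rewrite (map35_linquad FE) -(coef_mx_kervec [:: b0; b1; b2] [:: c0; c1; c2]).
exact: A2_equiv_rank jf (normal_jet_linquad _).
Qed.

(** The normal forms of the theorem are standard matrices up to a permutation of
    their rows. *)
Lemma rank_coef_mx (R : realType) r (s : 'S_3) (b c a : seq R) : (r <= 3)%N ->
  row_perm s (pid_mx r) = coef_mx b c a -> \rank (coef_mx b c a) = r.
Proof.
move=> r3 <-; rewrite row_permE eqmxMfull ?row_full_unit ?unitmx_perm//.
by rewrite rank_pid_mx.
Qed.

Theorem theorem3p9 (R : realType) (a21 a22 a12 b21 b22 b12 c21 c22 c12 : R)
  (f rho : 'rV[R]_3 -> 'rV[R]_5)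
  (f_corank1 : corank1_germ f)
  (rho_smooth : smooth_germ rho)
  (rho_order3 : jet2 rho = fun=> 0)
  (f_eq : \forall u \near (0 : 'rV[R]_3),
     f u = map35 (fun x y z =>
       [:: x; y; a21 * z ^+ 2 + a22 * x * z + a12 * y * z;
                 b21 * z ^+ 2 + b22 * x * z + b12 * y * z;
                 c21 * z ^+ 2 + c22 * x * z + c12 * y * z]) u + rho u) :
  [/\ A2_equiv f (map35 (fun x y z => [:: x; y; x * z; y * z; z ^+ 2])) <->
        substantial_surface (normal_subspace f) (curvature_locus f),
      A2_equiv f (map35 (fun x y z => [:: x; y; z ^+ 2; x * z; 0])) <->
        is_planar_region (curvature_locus f),
      A2_equiv f (map35 (fun x y z => [:: x; y; x * z; y * z; 0])) <->
        is_plane (curvature_locus f) &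
    [/\ A2_equiv f (map35 (fun x y z => [:: x; y; z ^+ 2; 0; 0])) <->
          is_half_line (curvature_locus f),
        A2_equiv f (map35 (fun x y z => [:: x; y; x * z; 0; 0])) <->
          is_line (curvature_locus f) &
        A2_equiv f (map35 (fun x y z => [:: x; y; 0; 0; 0])) <->
          is_point (curvature_locus f)]].
Proof.
have [f0 /smooth_twice_differentiable df _] := f_corank1.
have drho := smooth_twice_differentiable rho_smooth.
rewrite (@map35_linquad R _ a21 b21 c21 a22 b22 c22 a12 b12 c12) in f_eq; last first.
  by move=> x y z; congr [:: _; _; _; _; _]; ring.
have jf := @normal_jet_perturbation R 2 3 _ f _ rho (normal_jet_linquad _) df f0 drho rho_order3 f_eq.
have [surf region half flat] := @shape_ranks R 3 _ f jf.
have t10 : (1 == 0 :> R) = false by rewrite oner_eq0.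
have listE (a b c d e a' b' c' d' e' : R) :
  a = a' -> b = b' -> c = c' -> d = d' -> e = e' ->
  [:: a; b; c; d; e] = [:: a'; b'; c'; d'; e'] by move=> -> -> -> -> ->.
have r1 : \rank (coef_mx [:: 1; 0; 0] [:: 0; 1; 0] [:: 0; 0; 1 : R]) = 3%N.
  apply: (@rank_coef_mx _ _ 1%g) => //.
  by apply/matrixP; apply: ord3_enum; apply: ord3_enum; rewrite !mxE !permE.
have r2 : \rank (coef_mx [:: 0; 1; 0] [:: 0; 0; 0] [:: 1; 0; 0 : R]) = 2%N.
  apply: (@rank_coef_mx _ _ (tperm 0%R 1%R * tperm 0%R 2%R)%g) => //.
  by apply/matrixP; apply: ord3_enum; apply: ord3_enum; rewrite !mxE !permE /= !permE.
have r3 : \rank (coef_mx [:: 1; 0; 0] [:: 0; 1; 0] [:: 0; 0; 0 : R]) = 2%N.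
  apply: (@rank_coef_mx _ _ 1%g) => //.
  by apply/matrixP; apply: ord3_enum; apply: ord3_enum; rewrite !mxE !permE.
have r4 : \rank (coef_mx [:: 0; 0; 0] [:: 0; 0; 0] [:: 1; 0; 0 : R]) = 1%N.
  apply: (@rank_coef_mx _ _ (tperm 0 2)) => //.
  by apply/matrixP; apply: ord3_enum; apply: ord3_enum; rewrite !mxE !permE.
have r5 : \rank (coef_mx [:: 1; 0; 0] [:: 0; 0; 0] [:: 0; 0; 0 : R]) = 1%N.
  apply: (@rank_coef_mx _ _ 1%g) => //.
  by apply/matrixP; apply: ord3_enum; apply: ord3_enum; rewrite !mxE !permE.
have r6 : \rank (coef_mx [:: 0; 0; 0] [:: 0; 0; 0] [:: 0; 0; 0 : R]) = 0%N.
  apply: (@rank_coef_mx _ _ 1%g) => //.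
  by apply/matrixP; apply: ord3_enum; apply: ord3_enum; rewrite !mxE !permE.
have A2 F a0 a1 a2 b0 b1 b2 c0 c1 c2 :=
  @A2_equiv_map35 R _ f F a0 a1 a2 b0 b1 b2 c0 c1 c2 jf.
split; [| | |split].
- rewrite surf// (A2 _ 0 0 1 1 0 0 0 1 0) ?r1 ?t10 ?eqxx//.
  by move=> x y z; apply: listE; ring.
- rewrite region (A2 _ 1 0 0 0 1 0 0 0 0) ?r2 ?t10//.
  by move=> x y z; apply: listE; ring.
- rewrite /is_plane flat (A2 _ 0 0 0 1 0 0 0 1 0) ?r3 ?eqxx//.
  by move=> x y z; apply: listE; ring.
- rewrite half (A2 _ 1 0 0 0 0 0 0 0 0) ?r4 ?t10//.
  by move=> x y z; apply: listE; ring.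
- rewrite /is_line flat (A2 _ 0 0 0 1 0 0 0 0 0) ?r5 ?eqxx//.
  by move=> x y z; apply: listE; ring.
- rewrite is_point_flat flat (A2 _ 0 0 0 0 0 0 0 0 0) ?r6 ?eqxx//.
  by move=> x y z; apply: listE; ring.
Qed.
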